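(* Let $\mathfrak g$ be one of $\mathfrak{sl}_n$, $\mathfrak{so}_{2n+1}$, $\mathfrak{so}_{2n}$, $\mathfrak{sp}_{2n}$. Then $U_{r,s}(\mathfrak g)$ has the standard triangular decomposition $$U_{r,s}(\mathfrak g)\cong U_{r,s}(\mathfrak n^-)\otimes U^0\otimes U_{r,s}(\mathfrak n)$$ as vector spaces, where $U_{r,s}(\mathfrak n)$ (resp. $U_{r,s}(\mathfrak n^-)$) is the subalgebra generated by all $e_i$ (resp. all $f_i$), $i\in I$, and $U^0$ is the subalgebra $\mathbb K[\omega_i^{\pm1},\omega_i'^{\pm1}: i\in I]$ (Laurent polynomials). In particular, for $r=q$, $s=q^{-1}$, it induces a vector space isomorphism $U_q(\mathfrak g)\cong U_q(\mathfrak n^-)\otimes U_0\otimes U_q(\mathfrak n)$, where $U_q(\mathfrak g)$ is the quotient of $U_{q,q^{-1}}(\mathfrak g)$ by the Hopf ideal generated by the elements $\omega_i'-\omega_i^{-1}$ ($i\in I$), $U_q(\mathfrak n)$ (resp. $U_q(\mathfrak n^-)$) is its subalgebra generated by all $e_i$ (resp. all $f_i$), and $U_0=\mathbb K[\omega_i^{\pm1}: i\in I]$.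
   Context: ''Standard triangular decomposition'' means that the isomorphism is given by the multiplication map from the tensor product to the algebra. Base field: $\mathbb K=\mathbb Q(r,s)$, where $r,s$ are either two indeterminates, or nonzero parameters in $\mathbb C$ with $r^2\ne s^2$ (for the one-parameter part, $r=q$, $s=q^{-1}$ and $\mathbb K=\mathbb Q(q)$). Roots: $\epsilon_1,\dots,\epsilon_n$ is an orthonormal basis of $\mathbb R^n$ with inner product $(\,,)$; $\alpha_i=\epsilon_i-\epsilon_{i+1}$ for $1\le i<n$, and $\alpha_n=\epsilon_n$ for $\mathfrak{so}_{2n+1}$ (type $B_n$, $n\ge2$), $\alpha_n=2\epsilon_n$ for $\mathfrak{sp}_{2n}$ (type $C_n$, $n\ge2$), $\alpha_n=\epsilon_{n-1}+\epsilon_n$ for $\mathfrak{so}_{2n}$ (type $D_n$, $n\ge4$). Index set $I=\{1,\dots,n-1\}$ for $\mathfrak{sl}_n$ (type $A_{n-1}$), $I=\{1,\dots,n\}$ otherwise. $a_{ij}=2(\alpha_i,\alpha_j)/(\alpha_i,\alpha_i)$. Put $r_i=r^{(\alpha_i,\alpha_i)}$, $s_i=s^{(\alpha_i,\alpha_i)}$ in type $B$ and $r_i=r^{(\alpha_i,\alpha_i)/2}$, $s_i=s^{(\alpha_i,\alpha_i)/2}$ in types $A,C,D$. Structure constants $p_{ij}$, $i,j\in I$: Type $A$: $p_{ij}=r^{(\epsilon_j,\alpha_i)}s^{(\epsilon_{j+1},\alpha_i)}$. Type $B$: $p_{ij}=r^{2(\epsilon_j,\alpha_i)}s^{2(\epsilon_{j+1},\alpha_i)}$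 if $j<n$; $p_{in}=r^{2(\epsilon_n,\alpha_i)}$ if $i<n$; $p_{nn}=rs^{-1}$. Type $C$: $p_{ij}=r^{(\epsilon_j,\alpha_i)}s^{(\epsilon_{j+1},\alpha_i)}$ if $j<n$; $p_{in}=r^{2(\epsilon_n,\alpha_i)}$ if $i<n$; $p_{nn}=r^2s^{-2}$. Type $D$: $p_{ij}=r^{(\epsilon_j,\alpha_i)}s^{(\epsilon_{j+1},\alpha_i)}$ if $j<n$; $p_{in}=r^{(\epsilon_{n-1},\alpha_i)}s^{-(\epsilon_n,\alpha_i)}$ if $i\ne n-1$; $p_{n-1,n}=r^{-1}s^{-1}$. $U_{r,s}(\mathfrak g)$ is the unital associative $\mathbb K$-algebra generated by $e_i,f_i,\omega_i^{\pm1},\omega_i'^{\pm1}$ ($i\in I$) subject to: (1) the $\omega_i^{\pm1},\omega_j'^{\pm1}$ all commute and $\omega_i\omega_i^{-1}=\omega_j'\omega_j'^{-1}=1$; (2) $\omega_je_i\omega_j^{-1}=p_{ij}e_i$, $\ \omega_jf_i\omega_j^{-1}=p_{ij}^{-1}f_i$; (3) $\omega_j'e_i\omega_j'^{-1}=p_{ji}^{-1}e_i$, $\ \omega_j'f_i\omega_j'^{-1}=p_{ji}f_i$; (4) $[e_i,f_j]=\delta_{ij}\dfrac{\omega_i-\omega_i'}{r_i-s_i}$; (5) ($e$-Serre relations) Types $A,B,C$: $[e_i,e_j]=0$ for $|i-j|>1$. Type $D$: $[e_i,e_j]=0$ for $i\neq j$ with $a_{ij}=0$ and $\{i,j\}\ne\{n-1,n\}$,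 and $e_{n-1}e_n=rs\,e_ne_{n-1}$. Types $A,D$: for $i<j$ in $I$ with $a_{ij}=-1$, $e_i^2e_j-(r+s)e_ie_je_i+rs\,e_je_i^2=0$ and $e_j^2e_i-(r^{-1}+s^{-1})e_je_ie_j+r^{-1}s^{-1}e_ie_j^2=0$. Type $B$: $e_i^2e_{i+1}-(r_i+s_i)e_ie_{i+1}e_i+r_is_i\,e_{i+1}e_i^2=0$ for $1\le i<n$; $e_{j+1}^2e_j-(r_{j+1}^{-1}+s_{j+1}^{-1})e_{j+1}e_je_{j+1}+r_{j+1}^{-1}s_{j+1}^{-1}e_je_{j+1}^2=0$ for $1\le j<n-1$; $e_n^3e_{n-1}-(r^{-2}+r^{-1}s^{-1}+s^{-2})e_n^2e_{n-1}e_n+r^{-1}s^{-1}(r^{-2}+r^{-1}s^{-1}+s^{-2})e_ne_{n-1}e_n^2-r^{-3}s^{-3}e_{n-1}e_n^3=0$. Type $C$: for $1\le i<n-1$, $e_i^2e_{i+1}-(r+s)e_ie_{i+1}e_i+rs\,e_{i+1}e_i^2=0$ and $e_{i+1}^2e_i-(r^{-1}+s^{-1})e_{i+1}e_ie_{i+1}+r^{-1}s^{-1}e_ie_{i+1}^2=0$; $e_{n-1}^3e_n-(r^2+rs+s^2)e_{n-1}^2e_ne_{n-1}+rs(r^2+rs+s^2)e_{n-1}e_ne_{n-1}^2-(rs)^3e_ne_{n-1}^3=0$; $e_n^2e_{n-1}-(r^{-2}+s^{-2})e_ne_{n-1}e_n+r^{-2}s^{-2}e_{n-1}e_n^2=0$.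 (6) ($f$-Serre relations) each relation in (5) with every word reversed and every $e_k$ replaced by $f_k$. Hopf structure: $\omega_i^{\pm1},\omega_i'^{\pm1}$ are group-like, $\Delta(e_i)=e_i\otimes1+\omega_i\otimes e_i$, $\Delta(f_i)=1\otimes f_i+f_i\otimes\omega_i'$, $\varepsilon(e_i)=\varepsilon(f_i)=0$, $S(e_i)=-\omega_i^{-1}e_i$, $S(f_i)=-f_i\omega_i'^{-1}$. *)

(* Defs.v *)
From HB Require Import structures.
From mathcomp Require Import all_boot all_order all_algebra.
From mathcomp Require Import ring_quotient finmap.
From mathcomp Require Import boolp.
From mathcomp Require Import monalg.

Set Implicit Arguments.
Unset Strict Implicit.
Unset Printing Implicit Defensive.

Import GRing.Theory.
Local Open Scope ring_scope.
Local Open Scope quotient_scope.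

Fact lock_key : unit. Proof. exact: tt. Qed.

Section LinearSpan.
Variables (K : fieldType) (V : lmodType K) (S : V -> Prop).

Inductive lspan : V -> Prop :=
| lspan0 : lspan 0
| lspanS (k : K) (x y : V) : S x -> lspan y -> lspan (k *: x + y).

Lemma lspan_lin k x y : lspan x -> lspan y -> lspan (k *: x + y).
Proof.
move=> Lx Ly; elim: Lx => [|l u v Su _ IH]; first by rewrite scaler0 add0r.
by rewrite scalerDr scalerA -addrA; apply: lspanS.
Qed.

Lemma lspan_gen x : S x -> lspan x.
Proof. by move=> Sx; rewrite -[x]addr0 -[x]scale1r; apply/lspanS/lspan0. Qed.

Definition lspan_pred : {pred V} := fun x => `[< lspan x >].

Lemma lspan_predE x : (x \in lspan_pred) = `[< lspan x >]. Proof. by []. Qed.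

Lemma lspan_submod : submod_closed lspan_pred.
Proof.
split; first exact/asboolP/lspan0.
by move=> k x y /asboolP Lx /asboolP Ly; apply/asboolP/lspan_lin.
Qed.

HB.instance Definition _ :=
  GRing.isZmodClosed.Build V lspan_pred (GRing.submod_closedB lspan_submod).

Section Construction.
Local Notation Q := (Quotient.quot lspan_pred).

Definition lquot0 : Type := Q.
HB.instance Definition _ := GRing.Zmodule.on lquot0.

Definition lproj0 (x : V) : lquot0 := \pi_Q x.
Definition lrepr0 (q : lquot0) : V := repr (q : Q).

Lemma lrepr0K : cancel lrepr0 lproj0. Proof. exact: reprK. Qed.

Lemma lproj0_eq x y : lproj0 x = lproj0 y <-> lspan (x - y).
Proof.
split=> [/eqP|Lxy]; last apply/eqP.
  by rewrite -Quotient.idealrBE => /asboolP.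
by rewrite -Quotient.idealrBE; apply/asboolP.
Qed.

Lemma lproj0D x y : lproj0 (x + y) = lproj0 x + lproj0 y.
Proof. by rewrite /lproj0 !piE. Qed.

Definition lscale0 (k : K) (q : lquot0) : lquot0 := lproj0 (k *: lrepr0 q).

Lemma lscale0E k x : lscale0 k (lproj0 x) = lproj0 (k *: x).
Proof.
apply/lproj0_eq; rewrite -scalerBr -[_ *: _]addr0; apply/lspan_lin/lspan0.
by apply/lproj0_eq; rewrite lrepr0K.
Qed.

Lemma lscale0A a b q : lscale0 a (lscale0 b q) = lscale0 (a * b) q.
Proof. by rewrite -[q]lrepr0K !lscale0E scalerA. Qed.

Lemma lscale01 : left_id 1 lscale0.
Proof. by move=> q; rewrite -[q]lrepr0K lscale0E scale1r. Qed.

Lemma lscale0Dr : right_distributive lscale0 +%R.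
Proof.
move=> k p q; rewrite -[p]lrepr0K -[q]lrepr0K.
by rewrite -lproj0D !lscale0E scalerDr lproj0D.
Qed.

Lemma lscale0Dl q : {morph lscale0^~ q : a b / a + b}.
Proof. by move=> a b; rewrite -[q]lrepr0K !lscale0E scalerDl lproj0D. Qed.

HB.instance Definition _ := GRing.Zmodule_isLmodule.Build K lquot0
  lscale0A lscale01 lscale0Dr lscale0Dl.

Lemma lproj0_is_linear : linear lproj0.
Proof. by move=> k x y; rewrite lproj0D -lscale0E. Qed.

HB.instance Definition _ :=
  GRing.isLinear.Build K V lquot0 _ lproj0 lproj0_is_linear.

End Construction.

(* V / span S, kept opaque: only the linear surjection lproj from V, its kernel
   and a section lrepr of it are known. *)
Definition lquot_sig : {Q : lmodType K & {pr : {linear V -> Q} & {rp : Q -> V |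
  cancel rp pr /\ forall x y, pr x = pr y <-> lspan (x - y)}}}.
Proof.
exists lquot0, lproj0, lrepr0; split; [exact: lrepr0K | exact: lproj0_eq].
Qed.

Definition lquot : Type := tag lquot_sig.
HB.instance Definition _ := GRing.Lmodule.on lquot.

Definition lproj : {linear V -> lquot} := tag (tagged lquot_sig).

Definition lrepr : lquot -> V := sval (tagged (tagged lquot_sig)).

Lemma lreprK : cancel lrepr lproj.
Proof. exact: (svalP (tagged (tagged lquot_sig))).1. Qed.

Lemma lproj_eq x y : lproj x = lproj y <-> lspan (x - y).
Proof. exact: (svalP (tagged (tagged lquot_sig))).2. Qed.

Lemma lproj_surj (q : lquot) : exists x, q = lproj x.
Proof. by exists (lrepr q); rewrite lreprK. Qed.

End LinearSpan.

(* The two-sided ideal generated by S, and the quotient A / (S). *)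
Section AlgebraQuotient.
Variables (K : fieldType) (A : algType K).

Definition two_sided_ideal (J : A -> Prop) : Prop :=
  [/\ J 0, forall k x y, J x -> J y -> J (k *: x + y) &
      forall a x b, J x -> J (a * x * b)].

Definition ideal_gen (S : A -> Prop) : A -> Prop :=
  lspan (fun y => exists a x b, S x /\ y = a * x * b).

Lemma ideal_gen_two_sided S : two_sided_ideal (ideal_gen S).
Proof.
split; [exact: lspan0|move=> *; exact: lspan_lin|].
move=> a x b; elim=> [|k y z [a' [s [b' [Ss ->]]]] _ IH].
  by rewrite mulr0 mul0r; apply: lspan0.
rewrite mulrDr mulrDl -scalerAr -scalerAl; apply: lspanS => //.
by exists (a * a'), s, (b' * b); rewrite !mulrA.
Qed.

Lemma ideal_gen_sub S x : S x -> ideal_gen S x.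
Proof. by move=> Sx; apply: lspan_gen; exists 1, x, 1; rewrite mul1r mulr1. Qed.

Lemma ideal_gen_min S J : two_sided_ideal J -> (forall x, S x -> J x) ->
  forall x, ideal_gen S x -> J x.
Proof.
by move=> [J0 Jlin JM] SJ x; elim=> [//|k y z [a [s [b [/SJ Js ->]]]] _ Jz];
  apply/Jlin/Jz/JM.
Qed.

Variable S : A -> Prop.

Definition aquot : Type := lquot (fun y => exists a x b, S x /\ y = a * x * b).
HB.instance Definition _ := GRing.Lmodule.on aquot.

Definition aproj (x : A) : aquot := lproj _ x.

Lemma aproj_eq x y : aproj x = aproj y <-> ideal_gen S (x - y).
Proof. exact: lproj_eq. Qed.

Lemma aproj_surj (q : aquot) : exists x, q = aproj x.
Proof. exact: lproj_surj. Qed.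

Lemma aproj_is_linear : linear aproj.
Proof. exact: linearP. Qed.
HB.instance Definition _ := GRing.isLinear.Build K A aquot _ aproj aproj_is_linear.

Definition arepr (q : aquot) : A := lrepr q.

Lemma areprK : cancel arepr aproj.
Proof. exact: lreprK. Qed.

Definition aquot_mul (p q : aquot) : aquot :=
  locked_with lock_key (aproj (arepr p * arepr q)).

Lemma aquot_mulE x y : aquot_mul (aproj x) (aproj y) = aproj (x * y).
Proof.
rewrite /aquot_mul locked_withE; have [_ Ilin IM] := ideal_gen_two_sided S.
have Ix : ideal_gen S (arepr (aproj x) - x) by apply/aproj_eq; rewrite areprK.
have Iy : ideal_gen S (arepr (aproj y) - y) by apply/aproj_eq; rewrite areprK.
apply/aproj_eq; set u := arepr _; set v := arepr _.
have -> : u * v - x * y = 1 *: ((u - x) * v) + x * (v - y).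
  by rewrite scale1r mulrBl mulrBr addrA subrK.
apply: Ilin; first by have := IM 1 _ v Ix; rewrite mul1r.
by have := IM x _ 1 Iy; rewrite mulr1.
Qed.

Lemma aquot_mulA : associative aquot_mul.
Proof.
move=> p q t; have [x ->] := aproj_surj p; have [y ->] := aproj_surj q.
by have [z ->] := aproj_surj t; rewrite !aquot_mulE mulrA.
Qed.

Lemma aquot_mul1 : left_id (aproj 1) aquot_mul.
Proof. by move=> p; have [x ->] := aproj_surj p; rewrite aquot_mulE mul1r. Qed.

Lemma aquot_mulr1 : right_id (aproj 1) aquot_mul.
Proof. by move=> p; have [x ->] := aproj_surj p; rewrite aquot_mulE mulr1. Qed.

Lemma aquot_mulDl : left_distributive aquot_mul +%R.
Proof.
move=> p q t; have [x ->] := aproj_surj p; have [y ->] := aproj_surj q.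
have [z ->] := aproj_surj t.
by rewrite -linearD !aquot_mulE mulrDl linearD.
Qed.

Lemma aquot_mulDr : right_distributive aquot_mul +%R.
Proof.
move=> p q t; have [x ->] := aproj_surj p; have [y ->] := aproj_surj q.
have [z ->] := aproj_surj t.
by rewrite -linearD !aquot_mulE mulrDr linearD.
Qed.

HB.instance Definition _ := GRing.Zmodule_isPzRing.Build aquot
  aquot_mulA aquot_mul1 aquot_mulr1 aquot_mulDl aquot_mulDr.

Lemma aproj_is_monoid_morphism : monoid_morphism aproj.
Proof. by split=> // x y; rewrite -aquot_mulE. Qed.
HB.instance Definition _ :=
  GRing.isMonoidMorphism.Build A aquot aproj aproj_is_monoid_morphism.

Lemma aquot_scaleAl (k : K) (p q : aquot) : k *: (p * q) = (k *: p) * q.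
Proof.
have [x ->] := aproj_surj p; have [y ->] := aproj_surj q.
by rewrite -rmorphM -!linearZ_LR -rmorphM -scalerAl.
Qed.

Lemma aquot_scaleAr (k : K) (p q : aquot) : k *: (p * q) = p * (k *: q).
Proof.
have [x ->] := aproj_surj p; have [y ->] := aproj_surj q.
by rewrite -rmorphM -!linearZ_LR -rmorphM -scalerAr.
Qed.

End AlgebraQuotient.

(* V (x) W, as the free module on V * W modulo the bilinearity relations *)
Section Tensor.
Variables (K : fieldType) (V W : lmodType K).

Local Notation pure v w := (<< (v, w) >> : {malg K[(V * W)%type]}).

Inductive tens_rel : {malg K[(V * W)%type]} -> Prop :=
| tens_relDl v v' w : tens_rel (pure (v + v') w - (pure v w + pure v' w))
| tens_relDr v w w' : tens_rel (pure v (w + w') - (pure v w + pure v w'))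
| tens_relZl k v w : tens_rel (pure (k *: v) w - k *: pure v w)
| tens_relZr k v w : tens_rel (pure v (k *: w) - k *: pure v w).

Definition tens : Type := lquot tens_rel.
HB.instance Definition _ := GRing.Lmodule.on tens.

Definition tensor (v : V) (w : W) : tens := lproj _ (pure v w).

Lemma tensorDl v v' w : tensor (v + v') w = tensor v w + tensor v' w.
Proof. by rewrite -linearD; apply/lproj_eq/lspan_gen; exact: tens_relDl. Qed.

Lemma tensorDr v w w' : tensor v (w + w') = tensor v w + tensor v w'.
Proof. by rewrite -linearD; apply/lproj_eq/lspan_gen; exact: tens_relDr. Qed.

Lemma tensorZl k v w : tensor (k *: v) w = k *: tensor v w.
Proof. by rewrite -linearZ; apply/lproj_eq/lspan_gen; exact: tens_relZl. Qed.

Lemma tensorZr k v w : tensor v (k *: w) = k *: tensor v w.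
Proof. by rewrite -linearZ; apply/lproj_eq/lspan_gen; exact: tens_relZr. Qed.

Lemma tens_ind (P : tens -> Prop) : P 0 ->
  (forall k v w t, P t -> P (k *: tensor v w + t)) -> forall t, P t.
Proof.
move=> P0 PS t; have [g ->] := lproj_surj t; rewrite [g]monalgE.
elim: (enum_fset _) => [|[v w] s IH]; first by rewrite big_nil linear0.
rewrite big_cons linearD.
have -> : << g@_(v, w) *g (v, w) >> = g@_(v, w) *: pure v w.
  by apply/malgP => k; rewrite mcoeffZ !mcoeffU mulrnAr mulr1.
by rewrite linearZ; apply: PS.
Qed.

Variable Z : lmodType K.

Definition bilin (f : V -> W -> Z) : Prop :=
  (forall w, linear (f^~ w)) /\ (forall v, linear (f v)).

Definition tens_ext (f : V -> W -> Z) (g : {malg K[(V * W)%type]}) : Z :=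
  \sum_(p <- msupp g) g@_p *: f p.1 p.2.

Definition tens_lift (f : V -> W -> Z) (t : tens) : Z :=
  locked_with lock_key (tens_ext f (lrepr t)).

Lemma tens_extEw f g (d : {fset (V * W)%type}) : (msupp g `<=` d)%fset ->
  tens_ext f g = \sum_(p <- d) g@_p *: f p.1 p.2.
Proof.
move=> sgd; rewrite /tens_ext (big_fset_incl _ sgd) //= => p _.
by move=> /mcoeff_outdom ->; rewrite scale0r.
Qed.

Lemma tens_ext_linear f : linear (tens_ext f).
Proof.
move=> k g h; pose d := (msupp g `|` msupp h)%fset.
have sg : (msupp g `<=` d)%fset by apply: fsubsetUl.
have sh : (msupp h `<=` d)%fset by apply: fsubsetUr.
rewrite (tens_extEw _ sg) (tens_extEw _ sh).
rewrite (@tens_extEw _ _ d); last first.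
  apply: fsubset_trans (msuppD_le _ _) _; rewrite fsubUset sh andbT.
  exact: fsubset_trans (msuppZ_le _ _) sg.
rewrite scaler_sumr -big_split /=; apply: eq_bigr => p _.
by rewrite mcoeffD mcoeffZ scalerDl scalerA.
Qed.

HB.instance Definition _ f :=
  GRing.isLinear.Build K _ Z _ (tens_ext f) (tens_ext_linear f).

Lemma tens_extU f v w : tens_ext f (pure v w) = f v w.
Proof. by rewrite /tens_ext msuppU oner_eq0 big_seq_fset1 mcoeffUU scale1r. Qed.

Hypothesis (f : V -> W -> Z) (f_bilin : bilin f).

Lemma tens_ext_rel g : lspan tens_rel g -> tens_ext f g = 0.
Proof.
have [fl fr] := f_bilin.
have fDl v v' w : f (v + v') w = f v w + f v' w.
  by have := fl w 1 v v'; rewrite !scale1r.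
have fDr v w w' : f v (w + w') = f v w + f v w'.
  by have := fr v 1 w w'; rewrite !scale1r.
have f0l w : f 0 w = 0.
  by apply: (addrI (f 0 w)); rewrite -fDl !addr0.
have f0r v : f v 0 = 0.
  by apply: (addrI (f v 0)); rewrite -fDr !addr0.
elim=> [|k x y rx _ IH]; first exact: linear0.
rewrite linearP /= IH addr0; suff -> : tens_ext f x = 0 by rewrite scaler0.
have fZl c v w : f (c *: v) w = c *: f v w.
  by have := fl w c v 0; rewrite addr0 f0l addr0.
have fZr c v w : f v (c *: w) = c *: f v w.
  by have := fr v c w 0; rewrite addr0 f0r addr0.
case: rx => [v v' w|v w w'|c v w|c v w]; rewrite linearB /=.
- by rewrite linearD /= !tens_extU fDl subrr.
- by rewrite linearD /= !tens_extU fDr subrr.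
- by rewrite linearZ /= !tens_extU fZl subrr.
- by rewrite linearZ /= !tens_extU fZr subrr.
Qed.

Lemma tens_liftP g : tens_lift f (lproj _ g) = tens_ext f g.
Proof.
rewrite /tens_lift locked_withE; apply/eqP; rewrite -subr_eq0 -linearB.
by apply/eqP/tens_ext_rel/lproj_eq; rewrite lreprK.
Qed.

Lemma tens_liftE v w : tens_lift f (tensor v w) = f v w.
Proof. by rewrite tens_liftP tens_extU. Qed.

Lemma tens_lift_linear : linear (tens_lift f).
Proof.
move=> k s t; have [x ->] := lproj_surj s; have [y ->] := lproj_surj t.
by rewrite -linearP !tens_liftP tens_ext_linear.
Qed.

End Tensor.

Lemma linear_map0 (K : fieldType) (V W : lmodType K) (f : V -> W) :
  linear f -> f 0 = 0.
Proof.
move=> /(_ 1 0 0); rewrite scaler0 addr0 scale1r => f0.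
by apply: (addrI (f 0)); rewrite -f0 addr0.
Qed.

(* The algebra structure (a (x) b) (c (x) d) = ac (x) bd of A (x) B *)
Section TensorAlgebra.
Variables (K : fieldType) (A B : algType K).


Definition tens_mul1 (a : A) (b : B) (c : A) (d : B) : tens A B :=
  tensor (a * c) (b * d).

Definition tens_mul2 (t : tens A B) (a : A) (b : B) : tens A B :=
  tens_lift (tens_mul1 a b) t.

Definition tens_mul (s t : tens A B) : tens A B :=
  locked_with lock_key (tens_lift (tens_mul2 t) s).

Lemma tens_mul_def s t : tens_mul s t = tens_lift (tens_mul2 t) s.
Proof. exact: locked_withE. Qed.

Lemma tens_mul1_bilin a b : bilin (tens_mul1 a b).
Proof.
split=> [d k c c'|c k d d']; rewrite /tens_mul1.
  by rewrite mulrDr -scalerAr tensorDl tensorZl.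
by rewrite mulrDr -scalerAr tensorDr tensorZr.
Qed.

Lemma tens_mul2_linear a b : linear (fun t => tens_mul2 t a b).
Proof. exact/tens_lift_linear/tens_mul1_bilin. Qed.

Lemma tens_mul2E a b c d : tens_mul2 (tensor c d) a b = tensor (a * c) (b * d).
Proof. exact/tens_liftE/tens_mul1_bilin. Qed.

Lemma tens_mul2_bilin t : bilin (tens_mul2 t).
Proof.
split=> [b k a a'|a k b b']; elim/tens_ind: t => [|l c d t IH].
- by rewrite !(linear_map0 (tens_mul2_linear _ _)) scaler0 addr0.
- rewrite !tens_mul2_linear !tens_mul2E IH mulrDl -scalerAl tensorDl tensorZl.
  by rewrite !scalerDr !scalerA [k * l]mulrC addrACA.
- by rewrite !(linear_map0 (tens_mul2_linear _ _)) scaler0 addr0.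
- rewrite !tens_mul2_linear !tens_mul2E IH mulrDl -scalerAl tensorDr tensorZr.
  by rewrite !scalerDr !scalerA [k * l]mulrC addrACA.
Qed.

Lemma tens_mulE a b c d :
  tens_mul (tensor a b) (tensor c d) = tensor (a * c) (b * d).
Proof. by rewrite tens_mul_def (tens_liftE (tens_mul2_bilin _)) tens_mul2E. Qed.

Lemma tens_mul_linearl t : linear (tens_mul^~ t).
Proof.
move=> k s s'; rewrite !tens_mul_def.
exact: (tens_lift_linear (tens_mul2_bilin t)).
Qed.

Lemma tens_mul_linearr s : linear (tens_mul s).
Proof.
elim/tens_ind: s => [|l a b s IH] k t t'.
  by rewrite !(linear_map0 (tens_mul_linearl _)) scaler0 addr0.
rewrite !tens_mul_linearl IH !tens_mul_def !(tens_liftE (tens_mul2_bilin _)).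
by rewrite tens_mul2_linear !scalerDr !scalerA [k * l]mulrC addrACA.
Qed.

Lemma tens_mulA : associative tens_mul.
Proof.
move=> s t u; elim/tens_ind: s => [|k a b s IH].
  by rewrite !(linear_map0 (tens_mul_linearl _)).
rewrite !tens_mul_linearl -IH; congr (_ *: _ + _).
elim/tens_ind: t {IH} => [|l c d t IH].
  by rewrite !(linear_map0 (tens_mul_linearl _), linear_map0 (tens_mul_linearr _)).
rewrite tens_mul_linearl !tens_mul_linearr tens_mul_linearl -IH.
congr (_ *: _ + _); elim/tens_ind: u {IH} => [|m e f u IH].
  by rewrite !(linear_map0 (tens_mul_linearr _)).
rewrite !tens_mul_linearr IH; congr (_ *: _ + _).
by rewrite !tens_mulE (mulrA a) (mulrA b).
Qed.

Lemma tens_mul_id : left_id (tensor 1 1) tens_mul.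
Proof.
elim/tens_ind => [|k a b t IH]; first exact: (linear_map0 (tens_mul_linearr _)).
by rewrite tens_mul_linearr IH tens_mulE !mul1r.
Qed.

Lemma tens_mul_idr : right_id (tensor 1 1) tens_mul.
Proof.
elim/tens_ind => [|k a b t IH]; first exact: (linear_map0 (tens_mul_linearl _)).
by rewrite tens_mul_linearl IH tens_mulE !mulr1.
Qed.

Lemma tens_mulDl : left_distributive tens_mul +%R.
Proof.
by move=> s t u; have := tens_mul_linearl u 1 s t; rewrite !scale1r.
Qed.

Lemma tens_mulDr : right_distributive tens_mul +%R.
Proof.
by move=> s t u; have := tens_mul_linearr s 1 t u; rewrite !scale1r.
Qed.

HB.instance Definition _ := GRing.Zmodule_isPzRing.Build (tens A B)
  tens_mulA tens_mul_id tens_mul_idr tens_mulDl tens_mulDr.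

Lemma tensorM (a c : A) (b d : B) :
  tensor a b * tensor c d = tensor (a * c) (b * d).
Proof. exact: tens_mulE. Qed.

End TensorAlgebra.


Lemma malg_scaleAr (K : fieldType) (M : monomType) (k : K) (g h : {malg K[M]}) :
  k *: (g * h) = g * (k *: h).
Proof.
rewrite -(mul_malgC k h) mulrA -(mul_malgC k (g * h)) mulrA; congr (_ * _).
rewrite mul_malgC malgM_def malgZ_def fgmulgU.
by apply: eq_bigr => m _; rewrite mulrC mulm1.
Qed.

(* The free algebra K<X>: the monoid algebra of the free monoid on X, kept opaque
   up to the isomorphism falg_of with that algebra. *)
Section FreeAlgebra.
Variables (K : fieldType) (X : choiceType).

Local Notation M := {malg K[{fmonom X}]}.

Section Construction.

Definition falg0 : Type := M.
HB.instance Definition _ := GRing.Lalgebra.on falg0.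

Lemma falg0_scaleAr (k : K) (g h : falg0) : k *: (g * h) = g * (k *: h).
Proof. exact: malg_scaleAr. Qed.

HB.instance Definition _ :=
  GRing.Lalgebra_isAlgebra.Build K falg0 falg0_scaleAr.

End Construction.

Definition falg_sig : {F : algType K & {to : {linear M -> F} &
  {from : {linear F -> M} |
    [/\ cancel to from, cancel from to & monoid_morphism to]}}}.
Proof. by exists falg0, idfun, idfun. Qed.

Definition falg : Type := tag falg_sig.
HB.instance Definition _ := GRing.Algebra.on falg.

Definition falg_of : {linear M -> falg} := tag (tagged falg_sig).
Definition of_falg : {linear falg -> M} := sval (tagged (tagged falg_sig)).

Lemma falg_ofK : cancel falg_of of_falg.
Proof. by have [] := svalP (tagged (tagged falg_sig)). Qed.

Lemma of_falgK : cancel of_falg falg_of.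
Proof. by have [] := svalP (tagged (tagged falg_sig)). Qed.

Lemma falg_of_monoid_morphism : monoid_morphism falg_of.
Proof. by have [] := svalP (tagged (tagged falg_sig)). Qed.

Lemma of_falg_monoid_morphism : monoid_morphism of_falg.
Proof.
have [of1 ofM] := falg_of_monoid_morphism.
split=> [|x y]; apply: (can_inj falg_ofK); rewrite of_falgK ?of1 //.
by rewrite ofM !of_falgK.
Qed.

Definition fgen (x : X) : falg := falg_of << fmu x >>.

End FreeAlgebra.

(* The subalgebra generated by X, as a K-vector space in its own right *)
Section GeneratedSubalgebra.
Variables (K : fieldType) (A : algType K) (X : A -> Prop).

Inductive gensub : A -> Prop :=
| gensub_in x : X x -> gensub x
| gensub1 : gensub 1
| gensub_lin (k : K) x y : gensub x -> gensub y -> gensub (k *: x + y)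
| gensubM x y : gensub x -> gensub y -> gensub (x * y).

Definition gensub_pred : {pred A} := fun x => `[< gensub x >].

Lemma gensub_submod : submod_closed gensub_pred.
Proof.
split; last first.
  by move=> k x y /asboolP Gx /asboolP Gy; apply/asboolP/gensub_lin.
apply/asboolP; rewrite -[0](addNr (1 : A)) -scaleN1r.
exact: gensub_lin gensub1 gensub1.
Qed.

HB.instance Definition _ := GRing.isSubmodClosed.Build K A gensub_pred
  gensub_submod.

Record subalg : Type := Subalg { subalg_val :> A; _ : subalg_val \in gensub_pred }.
HB.instance Definition _ := [isSub for subalg_val].
HB.instance Definition _ := [Choice of subalg by <:].
HB.instance Definition _ := [SubChoice_isSubLmodule of subalg by <:].

End GeneratedSubalgebra.

Section Decompositions.
Variables (K : fieldType) (A : algType K).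

(* The multiplication map N (x) Z (x) P -> A, x (x) z (x) y |-> x z y, is an
   isomorphism of vector spaces, where N, Z, P are the subalgebras generated by
   the given sets. *)
Definition triangular_decomposition (genN genZ genP : A -> Prop) : Prop :=
  exists phi : {linear tens (tens (subalg genN) (subalg genZ)) (subalg genP) -> A},
    (forall (x : subalg genN) (z : subalg genZ) (y : subalg genP),
       phi (tensor (tensor x z) y) = val x * val z * val y) /\
    bijective phi.

Definition family (J : Type) (x : J -> A) (v : A) : Prop := exists j, v = x j.

Variables (J : finType) (x xi : J -> A).

Definition torus_gens (v : A) : Prop := exists j, v = x j \/ v = xi j.

Definition zpow (u ui : A) (a : int) : A :=
  match a with Posz m => u ^+ m | Negz m => ui ^+ m.+1 end.

Definition laurent_monomial (a : {ffun J -> int}) : A :=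
  \prod_(j : J) zpow (x j) (xi j) (a j).

(* The subalgebra K[x_j^{+-1}] generated by the x_j and their inverses xi_j is
   the Laurent polynomial algebra in the x_j: the Laurent monomials form a basis. *)
Definition laurent_polynomials : Prop :=
  [/\ forall j, x j * xi j = 1 /\ xi j * x j = 1,
      forall i j, x i * x j = x j * x i,
      forall u, gensub torus_gens u <->
                lspan (fun v => exists a, v = laurent_monomial a) u &
      forall (s : seq {ffun J -> int}) (c : {ffun J -> int} -> K), uniq s ->
        \sum_(a <- s) c a *: laurent_monomial a = 0 ->
        forall a, a \in s -> c a = 0].

End Decompositions.

Section BaseField.
Variable K : fieldType.

Inductive subfield_gen (X : K -> Prop) : K -> Prop :=
| subfield_in x : X x -> subfield_gen X x
| subfield1 : subfield_gen X 1
| subfieldB x y : subfield_gen X x -> subfield_gen X y -> subfield_gen X (x - y)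
| subfieldM x y : subfield_gen X x -> subfield_gen X y -> subfield_gen X (x * y)
| subfieldV x : subfield_gen X x -> subfield_gen X x^-1.

(* K = Q(r, s).  A field of characteristic 0 generated by two elements embeds in
   C, so this covers exactly, up to isomorphism, the parameters r, s in C with
   r, s != 0 and r^2 != s^2; two indeterminates are a special case. *)
Definition base_field (r s : K) : Prop :=
  [/\ [pchar K] =i pred0,
      forall x, subfield_gen (fun y => y = r \/ y = s) x,
      r != 0, s != 0 & r ^+ 2 != s ^+ 2].

End BaseField.

Inductive lie_type := TypeA | TypeB | TypeC | TypeD.

(* TypeA with parameter n is sl_n, of rank n - 1; the others have rank n. *)
Definition admissible (ty : lie_type) (n : nat) : bool :=
  match ty with TypeD => (4 <= n)%N | _ => (2 <= n)%N end.

Definition lie_rank (ty : lie_type) (n : nat) : nat :=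
  match ty with TypeA => n.-1 | _ => n end.

(* Indices i, j below are the 1-based ones; all inner products are integers. *)
Section Roots.
Variables (ty : lie_type) (n : nat).

Definition eps (j : nat) : 'rV[int]_n := \row_(k < n) ((k.+1 == j) : nat)%:Z.

Definition ip (x y : 'rV[int]_n) : int := \sum_(k < n) x 0 k * y 0 k.

Definition simple_root (i : nat) : 'rV[int]_n :=
  if (i < n)%N then eps i - eps i.+1 else
  match ty with
  | TypeA => 0 (* not an index *)
  | TypeB => eps n
  | TypeC => eps n *+ 2
  | TypeD => eps n.-1 + eps n
  end.

(* The division is exact. *)
Definition cartan (i j : nat) : int :=
  ((2 * ip (simple_root i) (simple_root j))%R
     %/ ip (simple_root i) (simple_root i))%Z.

(* r_i = r ^ half_length i; (alpha_i, alpha_i) is even outside type B. *)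
Definition half_length (i : nat) : int :=
  let l := ip (simple_root i) (simple_root i) in
  match ty with TypeB => l | _ => (l %/ 2)%Z end.

Variables (K : fieldType) (r s : K).

Definition struct_const (i j : nat) : K :=
  let a := simple_root i in
  match ty with
  | TypeA => r ^ ip (eps j) a * s ^ ip (eps j.+1) a
  | TypeB =>
      if (j < n)%N then r ^ (2 * ip (eps j) a) * s ^ (2 * ip (eps j.+1) a)
      else if (i < n)%N then r ^ (2 * ip (eps n) a)
      else r * s^-1
  | TypeC =>
      if (j < n)%N then r ^ ip (eps j) a * s ^ ip (eps j.+1) a
      else if (i < n)%N then r ^ (2 * ip (eps n) a)
      else r ^+ 2 * s ^- 2
  | TypeD =>
      if (j < n)%N then r ^ ip (eps j) a * s ^ ip (eps j.+1) a
      else if i != n.-1 then r ^ ip (eps n.-1) a * s ^ (- ip (eps n) a)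
      else r^-1 * s^-1
  end.

Definition ri (i : nat) : K := r ^ half_length i.
Definition si (i : nat) : K := s ^ half_length i.

End Roots.

(* e_i, f_i, omega_i^{+-1}, omega'_i^{+-1} *)
Inductive qgen (I : Type) :=
| Qe of I | Qf of I | Qw of I | Qwi of I | Qw' of I | Qwi' of I.

Section QgenChoice.
Variable I : choiceType.

Definition qgen_code (g : qgen I) : nat * I :=
  match g with
  | Qe i => (0, i) | Qf i => (1, i) | Qw i => (2, i)
  | Qwi i => (3, i) | Qw' i => (4, i) | Qwi' i => (5, i)
  end.

Definition qgen_decode (c : nat * I) : qgen I :=
  match c.1 with
  | 0 => Qe c.2 | 1 => Qf c.2 | 2 => Qw c.2
  | 3 => Qwi c.2 | 4 => Qw' c.2 | _ => Qwi' c.2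
  end.

Lemma qgen_codeK : cancel qgen_code qgen_decode. Proof. by case. Qed.

HB.instance Definition _ := Choice.copy (qgen I) (can_type qgen_codeK).

End QgenChoice.

Definition toral (I : Type) (g : qgen I) : bool :=
  match g with Qe _ | Qf _ => false | _ => true end.

Section QuantumGroup.
Variables (K : fieldType) (r s : K) (ty : lie_type) (n : nat).

Local Notation m := (lie_rank ty n).
Definition num (i : 'I_m) : nat := i.+1.

Local Notation p i j := (struct_const ty n r s (num i) (num j)).
Local Notation r_ i := (ri ty n r (num i)).
Local Notation s_ i := (si ty n s (num i)).
Local Notation a_ i j := (cartan ty n (num i) (num j)).

(* Noncommutative polynomials in letters indexed by I, as lists of terms
   (coefficient, word). *)
Definition ncpoly : Type := seq (K * seq 'I_m).

Definition nc_comm (i j : 'I_m) : ncpoly := [:: (1, [:: i; j]); (- 1, [:: j; i])].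

(* x^2 y - b x y x + c y x^2 *)
Definition nc_quadratic (x y : 'I_m) (b c : K) : ncpoly :=
  [:: (1, [:: x; x; y]); (- b, [:: x; y; x]); (c, [:: y; x; x])].

(* x^3 y - b x^2 y x + c x y x^2 - d y x^3 *)
Definition nc_cubic (x y : 'I_m) (b c d : K) : ncpoly :=
  [:: (1, [:: x; x; x; y]); (- b, [:: x; x; y; x]);
      (c, [:: x; y; x; x]); (- d, [:: y; x; x; x])].

Inductive serre : ncpoly -> Prop :=
| serre_comm i j : ty <> TypeD ->
    ((num i).+1 < num j)%N || ((num j).+1 < num i)%N ->
    serre (nc_comm i j)
| serre_D_comm i j : ty = TypeD -> i != j -> a_ i j = 0 ->
    ~~ ((num i == n.-1) && (num j == n) || (num i == n) && (num j == n.-1)) ->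
    serre (nc_comm i j)
| serre_D_last i j : ty = TypeD -> num i = n.-1 -> num j = n ->
    serre [:: (1, [:: i; j]); (- (r * s), [:: j; i])]
| serre_AD1 i j : ty = TypeA \/ ty = TypeD ->
    (num i < num j)%N -> a_ i j = - 1 ->
    serre (nc_quadratic i j (r + s) (r * s))
| serre_AD2 i j : ty = TypeA \/ ty = TypeD ->
    (num i < num j)%N -> a_ i j = - 1 ->
    serre (nc_quadratic j i (r^-1 + s^-1) (r^-1 * s^-1))
| serre_B1 i j : ty = TypeB -> (num i < n)%N -> num j = (num i).+1 ->
    serre (nc_quadratic i j (r_ i + s_ i) (r_ i * s_ i))
| serre_B2 i j : ty = TypeB -> (num i < n.-1)%N -> num j = (num i).+1 ->
    serre (nc_quadratic j i ((r_ j)^-1 + (s_ j)^-1) ((r_ j)^-1 * (s_ j)^-1))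
| serre_B3 i j : ty = TypeB -> num i = n.-1 -> num j = n ->
    let c := r ^- 2 + r^-1 * s^-1 + s ^- 2 in
    serre (nc_cubic j i c (r^-1 * s^-1 * c) (r ^- 3 * s ^- 3))
| serre_C1 i j : ty = TypeC -> (num i < n.-1)%N -> num j = (num i).+1 ->
    serre (nc_quadratic i j (r + s) (r * s))
| serre_C2 i j : ty = TypeC -> (num i < n.-1)%N -> num j = (num i).+1 ->
    serre (nc_quadratic j i (r^-1 + s^-1) (r^-1 * s^-1))
| serre_C3 i j : ty = TypeC -> num i = n.-1 -> num j = n ->
    let c := r ^+ 2 + r * s + s ^+ 2 in
    serre (nc_cubic i j c (r * s * c) ((r * s) ^+ 3))
| serre_C4 i j : ty = TypeC -> num i = n.-1 -> num j = n ->
    serre (nc_quadratic j i (r ^- 2 + s ^- 2) (r ^- 2 * s ^- 2)).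

Local Notation FA := (falg K (qgen 'I_m)).
Local Notation g_ x := (fgen K x).

Inductive urel : FA -> Prop :=
| urel_comm x y : toral x -> toral y -> urel (g_ x * g_ y - g_ y * g_ x)
| urel_w i : urel (g_ (Qw i) * g_ (Qwi i) - 1)
| urel_w' i : urel (g_ (Qw' i) * g_ (Qwi' i) - 1)
| urel_we i j :
    urel (g_ (Qw j) * g_ (Qe i) * g_ (Qwi j) - p i j *: g_ (Qe i))
| urel_wf i j :
    urel (g_ (Qw j) * g_ (Qf i) * g_ (Qwi j) - (p i j)^-1 *: g_ (Qf i))
| urel_w'e i j :
    urel (g_ (Qw' j) * g_ (Qe i) * g_ (Qwi' j) - (p j i)^-1 *: g_ (Qe i))
| urel_w'f i j :
    urel (g_ (Qw' j) * g_ (Qf i) * g_ (Qwi' j) - p j i *: g_ (Qf i))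
| urel_ef i j :
    urel (g_ (Qe i) * g_ (Qf j) - g_ (Qf j) * g_ (Qe i)
          - ((i == j)%:R / (r_ i - s_ i)) *: (g_ (Qw i) - g_ (Qw' i)))
| urel_serre_e q : serre q ->
    urel (\sum_(t <- q) t.1 *: \prod_(k <- t.2) g_ (Qe k))
| urel_serre_f q : serre q ->
    urel (\sum_(t <- q) t.1 *: \prod_(k <- rev t.2) g_ (Qf k)).

Definition Urs : Type := aquot urel.
HB.instance Definition _ := GRing.Lmodule.on Urs.
HB.instance Definition _ := GRing.PzRing.on Urs.

Definition ugen (x : qgen 'I_m) : Urs := aproj urel (g_ x).

(* The counit on the free algebra shows that U_{r,s}(g) is nontrivial. *)
Definition counit_mon (w : {fmonom (qgen 'I_m)}) : K :=
  \prod_(x <- (w : seq _)) (toral x)%:R.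

Lemma counit_mon_mmorphism : mmorphism counit_mon.
Proof.
split=> [x y|]; last by rewrite /counit_mon fm1 big_nil.
by rewrite /counit_mon fmM big_cat.
Qed.
HB.instance Definition _ :=
  isMultiplicative.Build _ _ counit_mon counit_mon_mmorphism.

Definition counit0 (g : FA) : K := mmap idfun counit_mon (of_falg K (qgen 'I_m) g).

Lemma counit0_is_linear : linear_for *%R counit0.
Proof.
move=> k x y; rewrite /counit0 linearP raddfD /=.
by congr (_ + _); apply: mmap_is_linear.
Qed.

HB.instance Definition _ :=
  GRing.isLinear.Build K FA K _ counit0 counit0_is_linear.

Lemma counit0M g h : counit0 (g * h) = counit0 g * counit0 h.
Proof.
rewrite /counit0 (of_falg_monoid_morphism K (qgen 'I_m)).2.
exact: (rmorphM (mmap idfun counit_mon)).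
Qed.

Lemma counit01 : counit0 1 = 1.
Proof. by rewrite /counit0 (of_falg_monoid_morphism K (qgen 'I_m)).1; apply: mmap1. Qed.

Lemma counit0_gen x : counit0 (g_ x) = (toral x)%:R.
Proof.
by rewrite /counit0 /fgen falg_ofK mmapU /= mul1r /counit_mon fmU big_seq1.
Qed.

Lemma counit0B g h : counit0 (g - h) = counit0 g - counit0 h.
Proof. exact: linearB. Qed.

Lemma counit0Z k g : counit0 (k *: g) = k * counit0 g.
Proof. exact: linearZ. Qed.

Lemma counit0_word (x : 'I_m -> qgen 'I_m) w : ~~ nilp w ->
  (forall i, ~~ toral (x i)) -> counit0 (\prod_(k <- w) g_ (x k)) = 0.
Proof.
case: w => //= i w _ nt; rewrite big_cons counit0M counit0_gen.
by rewrite (negPf (nt i)) mul0r.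
Qed.

Lemma serre_words q : serre q -> all (fun t => ~~ nilp t.2) q.
Proof. by case. Qed.

Lemma counit0_urel g : urel g -> counit0 g = 0.
Proof.
case=> {g} [x y tx ty'|i|i|i j|i j|i j|i j|i j|q /serre_words nq|q /serre_words nq].
- rewrite counit0B; apply/eqP; rewrite subr_eq0; apply/eqP.
  by rewrite (counit0M (g_ x) (g_ y)) (counit0M (g_ y) (g_ x)) mulrC.
- by rewrite counit0B counit0M counit01 !counit0_gen mulr1 subrr.
- by rewrite counit0B counit0M counit01 !counit0_gen mulr1 subrr.
- by rewrite counit0B counit0Z !counit0M !counit0_gen !(mulr0, mul0r) subrr.
- by rewrite counit0B counit0Z !counit0M !counit0_gen !(mulr0, mul0r) subrr.
- by rewrite counit0B counit0Z !counit0M !counit0_gen !(mulr0, mul0r) subrr.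
- by rewrite counit0B counit0Z !counit0M !counit0_gen !(mulr0, mul0r) subrr.
- rewrite 2!counit0B counit0Z counit0B !counit0M !counit0_gen.
  by rewrite !(mulr0, mul0r, subrr).
- rewrite linear_sum big_seq big1 //= => t /(allP nq) nt.
  by rewrite counit0Z counit0_word ?mulr0.
- rewrite linear_sum big_seq big1 //= => t /(allP nq) nt.
  by rewrite counit0Z counit0_word ?mulr0 // /nilp size_rev.
Qed.

Lemma counit0_ideal g : ideal_gen urel g -> counit0 g = 0.
Proof.
elim=> [|k x y [a [t [b [/counit0_urel t0 ->]]]] _ IH]; first exact: linear0.
by rewrite linearP /= !counit0M t0 mulr0 mul0r mulr0 IH addr0.
Qed.

Lemma Urs_nontrivial : (1 : Urs) != 0.
Proof.
apply/eqP=> U0; have : aproj urel 1 = aproj urel 0 by rewrite rmorph1 linear0.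
move/aproj_eq; rewrite subr0 => /counit0_ideal.
by rewrite counit01 => /eqP; rewrite oner_eq0.
Qed.

HB.instance Definition _ := GRing.PzSemiRing_isNonZero.Build Urs Urs_nontrivial.
HB.instance Definition _ :=
  GRing.LSemiModule_isLSemiAlgebra.Build K Urs (@aquot_scaleAl _ _ urel).
HB.instance Definition _ :=
  GRing.LSemiAlgebra_isSemiAlgebra.Build K Urs (@aquot_scaleAr _ _ urel).


(* The Hopf structure of U_{r,s}(g): the algebra maps Delta, epsilon and the
   antiautomorphism S with the prescribed values on the generators. *)
Record hopf_maps (Delta : {linear Urs -> tens Urs Urs})
    (epsilon : {linear Urs -> K^o}) (S : {linear Urs -> Urs}) : Prop := HopfMaps {
  Delta_morph : monoid_morphism Delta;
  Delta_toral x : toral x -> Delta (ugen x) = tensor (ugen x) (ugen x);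
  Delta_e i : Delta (ugen (Qe i)) =
    tensor (ugen (Qe i)) 1 + tensor (ugen (Qw i)) (ugen (Qe i));
  Delta_f i : Delta (ugen (Qf i)) =
    tensor 1 (ugen (Qf i)) + tensor (ugen (Qf i)) (ugen (Qw' i));
  epsilon_morph : monoid_morphism (epsilon : Urs -> K);
  epsilon_toral x : toral x -> epsilon (ugen x) = 1;
  epsilon_e i : epsilon (ugen (Qe i)) = 0;
  epsilon_f i : epsilon (ugen (Qf i)) = 0;
  S_1 : S 1 = 1;
  S_anti x y : S (x * y) = S y * S x;
  S_w i : S (ugen (Qw i)) = ugen (Qwi i);
  S_wi i : S (ugen (Qwi i)) = ugen (Qw i);
  S_w' i : S (ugen (Qw' i)) = ugen (Qwi' i);
  S_wi' i : S (ugen (Qwi' i)) = ugen (Qw' i);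
  S_e i : S (ugen (Qe i)) = - (ugen (Qwi i) * ugen (Qe i));
  S_f i : S (ugen (Qf i)) = - (ugen (Qf i) * ugen (Qwi' i))
}.

(* J (x) U + U (x) J *)
Definition tens_ideal (J : Urs -> Prop) : tens Urs Urs -> Prop :=
  lspan (fun t => exists x y, (J x \/ J y) /\ t = tensor x y).

(* The quantification is harmless: a map in hopf_maps is determined by its
   values on the generators. *)
Definition hopf_ideal (J : Urs -> Prop) : Prop :=
  two_sided_ideal J /\
  forall Delta epsilon S, hopf_maps Delta epsilon S ->
    forall x, J x -> [/\ tens_ideal J (Delta x), epsilon x = 0 & J (S x)].

Definition hopf_ideal_gen (X : Urs -> Prop) (u : Urs) : Prop :=
  forall J, hopf_ideal J -> (forall x, X x -> J x) -> J u.

Definition torus_rel (u : Urs) : Prop :=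
  exists i, u = ugen (Qw' i) - ugen (Qwi i).


Lemma tens_idealM J z t : two_sided_ideal J -> tens_ideal J t ->
  tens_ideal J (z * t) /\ tens_ideal J (t * z).
Proof.
move=> [_ _ JM] Jt; elim/tens_ind: z => [|k a b z [IHl IHr]].
  by rewrite mul0r mulr0; split; apply: lspan0.
have mulDl (u v w : tens Urs Urs) :
    (k *: u + v) * w = k *: (u * w : tens Urs Urs) + v * w.
  exact: tens_mul_linearl.
have mulDr (u v w : tens Urs Urs) :
    w * (k *: u + v) = k *: (w * u : tens Urs Urs) + w * v.
  exact: tens_mul_linearr.
rewrite mulDl mulDr; split; apply: lspan_lin => // {IHl IHr}.
  elim: Jt => [|l u v [x [y [Jxy ->]]] _ IH]; first by rewrite mulr0; apply: lspan0.
  rewrite [X in lspan _ X](tens_mul_linearr _ l); apply: lspan_lin => //.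
  apply: lspan_gen; exists (a * x), (b * y); split; last exact: tensorM.
  have [/(JM a x 1)|/(JM b y 1)] := Jxy; rewrite mulr1; first by left.
  by right.
elim: Jt => [|l u v [x [y [Jxy ->]]] _ IH]; first by rewrite mul0r; apply: lspan0.
rewrite [X in lspan _ X](tens_mul_linearl _ l); apply: lspan_lin => //.
apply: lspan_gen; exists (x * a), (y * b); split; last exact: tensorM.
have [/(JM 1 x a)|/(JM 1 y b)] := Jxy; rewrite mul1r; first by left.
by right.
Qed.

Lemma ugen_ww i : ugen (Qw i) * ugen (Qwi i) = 1.
Proof.
rewrite -rmorphM -(rmorph1 (aproj urel)).
exact/aproj_eq/ideal_gen_sub/urel_w.
Qed.

Lemma ugen_w'w' i : ugen (Qw' i) * ugen (Qwi' i) = 1.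
Proof.
rewrite -rmorphM -(rmorph1 (aproj urel)).
exact/aproj_eq/ideal_gen_sub/urel_w'.
Qed.

Lemma ugen_comm x y : toral x -> toral y -> ugen x * ugen y = ugen y * ugen x.
Proof.
move=> tx ty'; rewrite -!rmorphM.
exact/aproj_eq/ideal_gen_sub/urel_comm.
Qed.

Lemma torus_hopf_ideal : hopf_ideal (ideal_gen torus_rel).
Proof.
have Jts := ideal_gen_two_sided torus_rel; have [J0 Jlin JM] := Jts.
split=> // Delta epsilon S H x; elim=> [|k u v [a [w [b [Tw ->]]]] _ [ID IE IS]].
  by rewrite !linear0; split=> //; apply: lspan0.
have Jw := ideal_gen_sub Tw; have [i def_w] := Tw.
rewrite !linearP /= IE (Delta_morph H).2 (Delta_morph H).2.
rewrite (epsilon_morph H).2 (epsilon_morph H).2 !(S_anti H); split.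
- apply: lspan_lin => //.
  apply: (tens_idealM _ Jts _).2; apply: (tens_idealM _ Jts _).1.
  rewrite {1}def_w linearB /= !(Delta_toral H) //.
  set x1 := ugen (Qw' i); set x2 := ugen (Qwi i).
  have -> : tensor x1 x1 - tensor x2 x2 = 1 *: tensor w x1 + tensor x2 w.
    rewrite scale1r def_w -/x1 -/x2 -[- x2]scaleN1r tensorDl tensorDr.
    by rewrite tensorZl tensorZr !scaleN1r addrA subrK.
  apply: lspan_lin; apply: lspan_gen.
    by exists w, x1; split=> //; left.
  by exists x2, w; split=> //; right.
- by rewrite def_w linearB /= !(epsilon_toral H) // subrr mulr0 mul0r scaler0 addr0.
- apply: Jlin => //; rewrite mulrA; apply: (JM).
  rewrite def_w linearB /= (S_w' H) (S_wi H).
  have -> : ugen (Qwi' i) - ugen (Qw i) =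
      (- ugen (Qwi' i)) * (ugen (Qw' i) - ugen (Qwi i)) * ugen (Qw i).
    rewrite mulNr mulrBr (ugen_comm (x := Qwi' i)) // ugen_w'w' mulNr mulrBl mul1r.
    rewrite -mulrA (ugen_comm (x := Qwi i)) // ugen_ww mulr1 opprB.
    by [].
  by apply: JM; rewrite -def_w.
Qed.

Lemma hopf_ideal_genE u :
  hopf_ideal_gen torus_rel u <-> ideal_gen torus_rel u.
Proof.
split=> [|Tu J [Jts _] TJ]; last exact: ideal_gen_min Jts TJ _ Tu.
by apply; [exact: torus_hopf_ideal | exact: ideal_gen_sub].
Qed.

Definition counit (u : Urs) : K := counit0 (arepr u).

Lemma counitE g : counit (aproj urel g) = counit0 g.
Proof.
apply/eqP; rewrite -subr_eq0 -counit0B; apply/eqP/counit0_ideal.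
by apply/aproj_eq; rewrite areprK.
Qed.

Lemma counit_ideal u : ideal_gen torus_rel u -> counit u = 0.
Proof.
have c0 : counit 0 = 0 by rewrite -(linear0 (aproj urel)) counitE linear0.
have clin k x y : counit (k *: x + y) = k * counit x + counit y.
  by rewrite -[x]areprK -[y]areprK -linearP !counitE linearP.
have cM x y : counit (x * y) = counit x * counit y.
  by rewrite -[x]areprK -[y]areprK -rmorphM !counitE counit0M.
elim=> [//|k x y [a [w [b [[i ->] ->]]]] _ IH].
rewrite clin IH !cM -linearB counitE counit0B !counit0_gen subrr.
by rewrite mulr0 mul0r mulr0 addr0.
Qed.

Lemma hopf_ideal_gen_proper : ~ ideal_gen (hopf_ideal_gen torus_rel) 1.
Proof.
move=> I1; have /counit_ideal : ideal_gen torus_rel 1.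
  apply: ideal_gen_min (ideal_gen_two_sided _) _ _ I1.
  by move=> x /hopf_ideal_genE.
rewrite -(rmorph1 (aproj urel)) counitE counit01 => /eqP.
by rewrite oner_eq0.
Qed.

(* The quotient of U_{r,s}(g) by the Hopf ideal generated by the
   omega'_i - omega_i^{-1}. *)
Definition Urs_quot : Type := aquot (hopf_ideal_gen torus_rel).
HB.instance Definition _ := GRing.Lmodule.on Urs_quot.
HB.instance Definition _ := GRing.PzRing.on Urs_quot.

Lemma Urs_quot_nontrivial : (1 : Urs_quot) != 0.
Proof.
apply/eqP=> U0; apply: hopf_ideal_gen_proper; rewrite -[1]subr0.
by apply/aproj_eq; rewrite rmorph1 linear0.
Qed.

HB.instance Definition _ :=
  GRing.PzSemiRing_isNonZero.Build Urs_quot Urs_quot_nontrivial.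
HB.instance Definition _ := GRing.LSemiModule_isLSemiAlgebra.Build K Urs_quot
  (@aquot_scaleAl _ _ (hopf_ideal_gen torus_rel)).
HB.instance Definition _ := GRing.LSemiAlgebra_isSemiAlgebra.Build K Urs_quot
  (@aquot_scaleAr _ _ (hopf_ideal_gen torus_rel)).

Definition qgen_quot (x : qgen 'I_m) : Urs_quot :=
  aproj (hopf_ideal_gen torus_rel) (ugen x).

Definition Urs_w (j : 'I_m + 'I_m) : Urs :=
  match j with inl i => ugen (Qw i) | inr i => ugen (Qw' i) end.
Definition Urs_wi (j : 'I_m + 'I_m) : Urs :=
  match j with inl i => ugen (Qwi i) | inr i => ugen (Qwi' i) end.

Definition Urs_triangular : Prop :=
  laurent_polynomials Urs_w Urs_wi /\
  triangular_decomposition (family (fun i => ugen (Qf i)))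
    (torus_gens Urs_w Urs_wi) (family (fun i => ugen (Qe i))).

Definition Urs_quot_triangular : Prop :=
  laurent_polynomials (fun i => qgen_quot (Qw i)) (fun i => qgen_quot (Qwi i)) /\
  triangular_decomposition (family (fun i => qgen_quot (Qf i)))
    (torus_gens (fun i => qgen_quot (Qw i)) (fun i => qgen_quot (Qwi i)))
    (family (fun i => qgen_quot (Qe i))).

End QuantumGroup.

(* Main.v *)
From HB Require Import structures.
Require Import Defs.
From mathcomp Require Import all_boot all_order all_algebra.
From mathcomp Require Import finmap boolp functions.
From mathcomp Require Import monalg ring zify.
Import GRing.Theory.
Local Open Scope ring_scope.

(** The algebra U = U_{r,s}(g) is presented by generators and relations, so
    what has to be shown is that its relations force no more than expected:
    the ordered monomials f_u g e_v (u and v words, g a Laurent monomial of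
    the torus) satisfy no linear relation besides those that hold inside the
    subalgebras generated by the f_i and by the e_i.

    The classical argument lets U act on N^- (x) U^0 (x) N, where N and N^- are
    free algebras modulo Serre relations, by the formulas that left
    multiplication has to obey.  Here this is dualized.  For an arbitrary
    vector space T, the functionals phi : G -> words -> words -> T, with G the
    lattice of exponents of the torus, stand for the linear maps
    g f_u e_v |-> phi g u v, and the free algebra on the generators of U acts
    on them from the right, as the transpose of left multiplication
    ([translate], [fop], [eop], [qop]).  The action of e_i rests on
      e_i f_u = f_u e_i + c_i (omega_i D(f_u) - omega'_i D'(f_u)),
    where D and D' are skew derivations of the free algebra ([skewder]).
    Functions of words thus replace tensor products and quotients of free
    algebras, and T can be chosen at the end.

    The torus relations and the commutators [e_i, f_j] act by zero on all
    functionals.  The Serre relations act by zero on those functionals that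
    respect the Serre relations in both word variables ([kills]); this space
    is stable because each Serre polynomial is homogeneous and is killed by
    all D and D' ([serre_skew_null]).  It is in this last fact that the types
    A, B, C, D matter: it says that the coefficients of the Serre relation of
    x and y are the elementary symmetric functions of a
    geometric progression running from p_yx to 1/p_xy with ratio p_xx.  For
    the f-Serre relations it is then immediate that they act by zero
    ([f_relation]).  For the e-Serre relations one uses that a Serre
    polynomial in the e_k commutes with every f_j, which is again the
    vanishing of the skew derivations ([fop_eword], [e_relation]).

    Hence the action descends to U ([act_urel]).  Evaluating the image of phi
    under f_u g e_v at the origin gives phi g u v up to a nonzero scalar
    ([lift_act_triangular]).  With T = K and phi an indicator function this
    proves that the Laurent monomials are independent ([laurent_torus]).  With
    T the tensor product of the three subalgebras and phi g u v a multiple of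
    f_u (x) g (x) e_v it gives a linear map from U to T ([split_map]), which inverts the
    multiplication map because the ordered monomials span U ([ordered_span]).

    For U_q(g) the same proof applies with a smaller lattice G, in which
    omega'_i is the inverse of omega_i.  This is consistent because for
    s = 1/r the matrix p is symmetric ([struct_const_one_param]). *)

Set Implicit Arguments.
Unset Strict Implicit.
Unset Printing Implicit Defensive.

(** * Right actions of a free algebra *)

Section FreeAction.
Variables (K : fieldType) (X : choiceType).
Local Notation FA := (falg K X).
Local Notation to_malg := (of_falg K X).

Definition gword (w : seq X) : FA := \prod_(x <- w) fgen K x.

Lemma to_malg_gword (w : {fmonom X}) : to_malg (gword w) = << w >>.
Proof.
have [to1 toM] := of_falg_monoid_morphism K X; rewrite /gword.
have [s] : exists s, s = (w : seq X) by exists w.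
move=> def_s; rewrite -def_s; elim: s w def_s => [|x s IH] w def_w.
  rewrite big_nil to1; congr << _ >>; apply/val_inj => /=.
  by rewrite fm1.
rewrite big_cons toM; pose w' := @FMonom X s.
rewrite (IH w') // /fgen falg_ofK malgM_def fgmulUU mulr1; congr << _ >>.
by apply/val_inj; rewrite /= fmM fmU -def_w.
Qed.

(** The words span the free algebra; all identities between linear maps out of
    it are checked on them. *)
Lemma falg_ind (P : FA -> Prop) : P 0 ->
  (forall k w a, P a -> P (k *: gword w + a)) -> forall a, P a.
Proof.
move=> P0 PS a; rewrite -[a](of_falgK (K:=K)) [to_malg a]monalgE.
elim: (enum_fset _) => [|w s IH]; first by rewrite big_nil linear0.
rewrite big_cons linearD.
have -> : << (to_malg a)@_w *g w >> = (to_malg a)@_w *: << w >>.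
  by apply/malgP => k; rewrite mcoeffZ !mcoeffU mulrnAr mulr1.
by rewrite linearZ -to_malg_gword of_falgK; apply: PS.
Qed.

Variables (V : lmodType K) (op : X -> {linear V -> V}).

Definition act_word (v : V) (w : seq X) : V := foldl (fun u x => op x u) v w.

Definition act (v : V) (a : FA) : V :=
  \sum_(w <- msupp (to_malg a)) (to_malg a)@_w *: act_word v w.

Lemma act_wordP w : linear (act_word^~ w).
Proof. by elim: w => //= x w IH k u v; rewrite linearP IH. Qed.

Lemma actEw v a (d : {fset {fmonom X}}) : (msupp (to_malg a) `<=` d)%fset ->
  act v a = \sum_(w <- d) (to_malg a)@_w *: act_word v w.
Proof.
move=> sad; rewrite /act (big_fset_incl _ sad) //= => w _.
by move=> /mcoeff_outdom ->; rewrite scale0r.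
Qed.

Lemma act_linear v : linear (act v).
Proof.
move=> k a b; pose d := (msupp (to_malg a) `|` msupp (to_malg b))%fset.
have sa : (msupp (to_malg a) `<=` d)%fset by apply: fsubsetUl.
have sb : (msupp (to_malg b) `<=` d)%fset by apply: fsubsetUr.
rewrite (actEw v sa) (actEw v sb) (@actEw _ _ d); last first.
  rewrite linearP; apply: fsubset_trans (msuppD_le _ _) _.
  rewrite fsubUset sb andbT; exact: fsubset_trans (msuppZ_le _ _) sa.
rewrite scaler_sumr -big_split /=; apply: eq_bigr => w _.
by rewrite linearP mcoeffD mcoeffZ scalerDl scalerA.
Qed.

HB.instance Definition _ v := GRing.isLinear.Build K FA V _ (act v) (act_linear v).

Lemma act_gword v (w : seq X) : act v (gword w) = act_word v w.
Proof.
rewrite -[w]/(val (@FMonom X w)) /act to_malg_gword msuppU oner_eq0.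
by rewrite big_seq_fset1 mcoeffUU scale1r.
Qed.

Lemma act_linearl a : linear (act^~ a).
Proof.
move=> k u v; rewrite /act scaler_sumr -big_split; apply: eq_bigr => w _ /=.
by rewrite act_wordP scalerDr !scalerA mulrC.
Qed.

Lemma act1 v : act v 1 = v.
Proof. by have := act_gword v [::]; rewrite /gword big_nil. Qed.

Lemma act_gen v x : act v (fgen K x) = op x v.
Proof. by have := act_gword v [:: x]; rewrite /gword big_seq1. Qed.

Lemma actM v a b : act v (a * b) = act (act v a) b.
Proof.
elim/falg_ind: a => [|k w a IH].
  by rewrite mul0r linear0 (linear_map0 (act_linearl b)).
rewrite mulrDl -scalerAl !linearP /= IH act_linearl; congr (_ *: _ + _).
elim/falg_ind: b {IH} => [|l z b IH]; first by rewrite mulr0 !linear0.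
rewrite mulrDr -scalerAr !linearP /= IH; congr (_ *: _ + _).
have -> : gword w * gword z = gword (w ++ z) by rewrite /gword big_cat.
by rewrite !act_gword /act_word foldl_cat.
Qed.

Lemma act_ind (P : V -> Prop) : P 0 ->
    (forall k u v, P u -> P v -> P (k *: u + v)) ->
    (forall x v, P v -> P (op x v)) ->
  forall v a, P v -> P (act v a).
Proof.
move=> P0 Plin Pop v a Pv; elim/falg_ind: a => [|k w a IH].
  by rewrite linear0.
rewrite linearP /=; apply: Plin => //; rewrite act_gword.
by elim: w v Pv {IH} => //= x w IH v /(Pop x)/IH.
Qed.

(** This is how an action descends to an algebra given by generators and
    relations, on an invariant subspace P. *)
Lemma act_ideal (P : V -> Prop) (S : FA -> Prop) :
    (forall v a, P v -> P (act v a)) ->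
    (forall v a, S a -> P v -> act v a = 0) ->
  forall v a, ideal_gen S a -> P v -> act v a = 0.
Proof.
move=> Pact SP v a + Pv; elim=> [|k x y [b [s [d [Ss ->]]]] _ IH].
  exact: linear0.
rewrite linearP /= IH addr0 !actM (SP _ _ Ss) ?(linear_map0 (act_linearl d)) //.
  by rewrite scaler0.
exact: Pact.
Qed.

End FreeAction.

(* From here on only the module laws of act matter, not its formula. *)
Opaque act.

Lemma linear_mapZ (K : fieldType) (V W : lmodType K) (f : V -> W) k v :
  linear f -> f (k *: v) = k *: f v.
Proof. by move=> lf; have := lf k v 0; rewrite (linear_map0 lf) !addr0. Qed.

(** * Skew derivations on words *)

Section SkewDerivation.
Variables (K : fieldType) (I : eqType).

(** The transpose psi o d of the skew derivation d of the free algebra that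
    sends the letter j to [i = j] and obeys
    d (j w) = rho j * j (d w) + [i = j] w.  Acting on functions of words
    instead of words avoids all linear combinations of words. *)
Fixpoint skewder (V : lmodType K) (i : I) (rho : I -> K) (psi : seq I -> V)
    (w : seq I) : V :=
  if w is j :: w' then
    rho j *: skewder i rho (fun x => psi (j :: x)) w' + (i == j)%:R *: psi w'
  else 0.

Lemma skewder_linear (V : lmodType K) i rho w :
  linear (fun psi : seq I -> V => skewder i rho psi w).
Proof.
elim: w => /= [|j w IH] k psi chi; first by rewrite scaler0 addr0.
have -> : (fun x => (k *: psi + chi) (j :: x)) =
  k *: (fun x => psi (j :: x)) + (fun x => chi (j :: x)) by [].
have -> : (k *: psi + chi) w = k *: psi w + chi w by [].
by rewrite IH !scalerDr !scalerA addrACA ![k * _]mulrC.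
Qed.

Lemma skewder0 (V : lmodType K) i rho w : skewder i rho (fun=> 0 : V) w = 0.
Proof. exact: (linear_map0 (skewder_linear i rho w)). Qed.

Lemma skewder_comp (V W : lmodType K) (f : V -> W) i rho psi w : linear f ->
  f (skewder i rho psi w) = skewder i rho (fun x => f (psi x)) w.
Proof.
move=> lf; elim: w psi => [|j w IH] psi /=; first exact: linear_map0.
by rewrite lf (linear_mapZ _ _ lf) IH.
Qed.

(** The twisted Leibniz rule d (a b) = d a * b + rho a * a (d b). *)
Lemma skewder_cat (V : lmodType K) i rho (psi : seq I -> V) a b :
  skewder i rho psi (a ++ b) = skewder i rho (fun x => psi (x ++ b)) a
    + (\prod_(j <- a) rho j) *: skewder i rho (fun x => psi (a ++ x)) b.
Proof.
elim: a psi => [|j a IH] psi /=; first by rewrite big_nil scale1r add0r.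
by rewrite IH big_cons scalerDr scalerA addrAC.
Qed.

End SkewDerivation.

Section Eval.
Variables (K : fieldType) (I : eqType).

(** The value at q of the linear extension of psi to noncommutative
    polynomials, q being given as a list of terms (coefficient, word). *)
Definition nceval (V : lmodType K) (q : seq (K * seq I)) (psi : seq I -> V) : V :=
  \sum_(t <- q) t.1 *: psi t.2.

Lemma nceval_linear (V : lmodType K) q :
  linear (fun psi : seq I -> V => nceval q psi).
Proof.
move=> k psi chi; rewrite /nceval scaler_sumr -big_split; apply: eq_bigr => t _.
by rewrite scalerDr !scalerA mulrC.
Qed.

Lemma nceval0 (V : lmodType K) q : nceval q (fun=> 0 : V) = 0.
Proof. by rewrite /nceval big1 // => t _; rewrite scaler0. Qed.

Lemma ncevalD (V : lmodType K) q (psi chi : seq I -> V) :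
  nceval q (fun w => psi w + chi w) = nceval q psi + nceval q chi.
Proof. by rewrite -[nceval q psi]scale1r -nceval_linear scale1r. Qed.

Lemma ncevalZ (V : lmodType K) q k (psi : seq I -> V) :
  nceval q (fun w => k *: psi w) = k *: nceval q psi.
Proof.
by rewrite /nceval scaler_sumr; apply: eq_bigr => t _; rewrite !scalerA mulrC.
Qed.

Lemma nceval_comp (V W : lmodType K) (f : V -> W) q psi : linear f ->
  nceval q (fun w => f (psi w)) = f (nceval q psi).
Proof.
move=> lf; rewrite /nceval; elim: q => [|t q IH].
  by rewrite !big_nil linear_map0.
by rewrite !big_cons lf IH.
Qed.

Lemma nceval_app (U : Type) (V : lmodType K) q (psi : seq I -> U -> V) x :
  nceval q psi x = nceval q (fun w => psi w x).
Proof. by rewrite /nceval fct_sumE. Qed.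

Lemma nceval_skewder (V : lmodType K) q i rho (psi : seq I -> seq I -> V) u :
  nceval q (fun w => skewder i rho (psi w) u) = skewder i rho (nceval q psi) u.
Proof.
exact: (nceval_comp (f := fun chi => skewder i rho chi u) q psi
  (skewder_linear i rho u)).
Qed.

Definition homogeneous (q : seq (K * seq I)) : Prop :=
  forall t t', t \in q -> t' \in q -> perm_eq t.2 t'.2.

(** On a homogeneous polynomial a weight that depends on the letters of a word
    only through their multiplicities is a constant factor. *)
Lemma nceval_weight (V : lmodType K) q (wt : seq I -> K) (psi : seq I -> V) :
    homogeneous q -> (forall w w', perm_eq w w' -> wt w = wt w') ->
  nceval q psi = 0 -> nceval q (fun w => wt w *: psi w) = 0.
Proof.
move=> hom_q wtP; case: q hom_q => [|t q] hom_q; first by rewrite /nceval !big_nil.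
suff -> : nceval (t :: q) (fun w => wt w *: psi w) = wt t.2 *: nceval (t :: q) psi.
  by move=> ->; rewrite scaler0.
rewrite /nceval scaler_sumr; apply: eq_big_seq => t' qt'.
by rewrite !scalerA mulrC (wtP t'.2 t.2) ?hom_q ?mem_head.
Qed.

(** A skew derivation that kills q preserves the ideal generated by q: by the
    twisted Leibniz rule, d (a q b) = d a * q b + a * d q * b + a q * d b up to
    scalars. *)
Lemma nceval_skewder_ideal (V : lmodType K) q i rho (psi : seq I -> V) a b :
    homogeneous q ->
    (forall psi : seq I -> V, nceval q (fun w => skewder i rho psi (rev w)) = 0) ->
    (forall a b, nceval q (fun w => psi (a ++ rev w ++ b)) = 0) ->
  nceval q (fun w => skewder i rho psi (a ++ rev w ++ b)) = 0.
Proof.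
move=> hom_q kill_q psi_q.
under eq_fun do rewrite skewder_cat skewder_cat scalerDr scalerA.
rewrite !ncevalD nceval_skewder !ncevalZ kill_q scaler0 add0r.
have -> : nceval q (fun w x => psi (x ++ rev w ++ b)) = (fun=> 0).
  by apply/funext => x; rewrite nceval_app psi_q.
rewrite skewder0 add0r.
under eq_fun do rewrite mulrC -scalerA.
apply: (nceval_weight (wt := fun w => \prod_(j <- rev w) rho j) hom_q).
  by move=> w w' eq_w; rewrite !(perm_big _ (permEl (perm_rev _))) (perm_big _ eq_w).
rewrite ncevalZ nceval_skewder.
have -> : nceval q (fun w x => psi (a ++ rev w ++ x)) = (fun=> 0).
  by apply/funext => x; rewrite nceval_app psi_q.
by rewrite skewder0 scaler0.
Qed.

End Eval.

(** * The action on functionals *)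

(* G is the multiplicative group of torus monomials, written additively: om i
   and om' i are omega_i and omega'_i, and chi i g is the weight in
   g e_i = chi i g * e_i g.  The commutator of e_i and f_i is
   c i * (omega_i - omega'_i). *)
Section Functionals.
Variables (K : fieldType) (I : choiceType) (G : zmodType).
Variables (chi : I -> G -> K) (om om' : I -> G) (c : I -> K).
Hypothesis chi0 : forall i, chi i 0 = 1.
Hypothesis chiD : forall i g h, chi i (g + h) = chi i g * chi i h.

Lemma chi_neq0 i g : chi i g != 0.
Proof.
apply: contra_eq_neq (chiD i g (- g)) => ->.
by rewrite subrr chi0 mul0r oner_eq0.
Qed.

Lemma chiN i g : chi i (- g) = (chi i g)^-1.
Proof.
apply: (mulIf (chi_neq0 i g)).
by rewrite -chiD addNr chi0 mulVf ?chi_neq0.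
Qed.

Variable T : lmodType K.
Local Notation Fn := (G -> seq I -> seq I -> T).

(** A functional phi stands for the linear map g f_u e_v |-> phi g u v, and
    translate h, fop j and eop i for its composites with left multiplication
    by h, f_j and e_i.  Putting g in front makes f_j g = chi j g * g f_j the
    only rule needed for fop. *)
Definition translate (h : G) (phi : Fn) : Fn := fun g => phi (g + h).

Definition fop (j : I) (phi : Fn) : Fn :=
  fun g u v => chi j g *: phi g (j :: u) v.

(** The formula comes from e_i g = (chi i g)^-1 g e_i and
    e_i f_u = f_u e_i + c_i (omega_i D f_u - omega'_i D' f_u), where moving
    omega_i to the left across a letter f_j costs chi j (om i). *)
Definition eop (i : I) (phi : Fn) : Fn := fun g u v =>
  (chi i g)^-1 *: (phi g u (i :: v)
    + c i *: (skewder i (chi^~ (om i)) (fun x => phi (g + om i) x v) u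
              - skewder i (chi^~ (om' i)) (fun x => phi (g + om' i) x v) u)).

Lemma FnP (phi psi : Fn) : (forall g u v, phi g u v = psi g u v) -> phi = psi.
Proof. by move=> eq_phi; do 3 apply/funext => ?; apply: eq_phi. Qed.

Lemma FnE k (phi psi : Fn) g u v :
  (k *: phi + psi) g u v = k *: phi g u v + psi g u v.
Proof. by []. Qed.

Lemma translate_linear h : linear (translate h).
Proof. by []. Qed.

Lemma fop_linear j : linear (fop j).
Proof.
by move=> k phi psi; apply: FnP => g u v; rewrite /fop !FnE scalerDr !scalerA mulrC.
Qed.

Lemma eop_linear i : linear (eop i).
Proof.
move=> k phi psi; apply: FnP => g u v; rewrite FnE /eop FnE.
rewrite (skewder_linear i _ u k (fun x => phi (g + om i) x v)
           (fun x => psi (g + om i) x v)).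
rewrite (skewder_linear i _ u k (fun x => phi (g + om' i) x v)
           (fun x => psi (g + om' i) x v)).
rewrite opprD addrACA -scalerBr (scalerDr (c i)) scalerA (mulrC (c i)) -scalerA.
by rewrite addrACA -scalerDr [LHS]scalerDr [LHS]addrC [RHS]addrC !scalerA mulrC.
Qed.

HB.instance Definition _ h :=
  GRing.isLinear.Build K Fn Fn _ (translate h) (translate_linear h).
HB.instance Definition _ j :=
  GRing.isLinear.Build K Fn Fn _ (fop j) (fop_linear j).
HB.instance Definition _ i :=
  GRing.isLinear.Build K Fn Fn _ (eop i) (eop_linear i).

Definition shift_of (x : qgen I) : G :=
  match x with
  | Qw i => om i | Qwi i => - om i | Qw' i => om' i | Qwi' i => - om' i
  | _ => 0
  end.

Definition qop (x : qgen I) : {linear Fn -> Fn} :=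
  match x with
  | Qe i => eop i
  | Qf j => fop j
  | x => translate (shift_of x)
  end.

Lemma qop_toral x : toral x -> qop x =1 translate (shift_of x).
Proof. by case: x. Qed.

Lemma translateD g h phi : translate g (translate h phi) = translate (g + h) phi.
Proof. by apply: FnP => k u v; rewrite /translate addrA. Qed.

Lemma translate0 phi : translate 0 phi = phi.
Proof. by apply: FnP => k u v; rewrite /translate addr0. Qed.

Lemma eop_translate i h phi :
  eop i (translate h phi) = chi i h *: translate h (eop i phi).
Proof.
apply: FnP => g u v; rewrite /eop /translate.
rewrite [RHS]scalerA chiD invfM mulrCA divff ?chi_neq0 // mulr1.
by rewrite ![g + h + _]addrAC.
Qed.

Lemma fop_translate j h phi :
  fop j (translate h phi) = (chi j h)^-1 *: translate h (fop j phi).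
Proof.
apply: FnP => g u v; rewrite /fop /translate.
by rewrite [RHS]scalerA chiD mulrCA mulVf ?chi_neq0 ?mulr1.
Qed.

Lemma eop_conj i h phi :
  translate (- h) (eop i (translate h phi)) = chi i h *: eop i phi.
Proof.
rewrite eop_translate (linear_mapZ _ _ (translate_linear _)) translateD addNr.
by rewrite translate0.
Qed.

Lemma fop_conj j h phi :
  translate (- h) (fop j (translate h phi)) = (chi j h)^-1 *: fop j phi.
Proof.
rewrite fop_translate (linear_mapZ _ _ (translate_linear _)) translateD addNr.
by rewrite translate0.
Qed.

(** Transpose of the relation [e_i, f_j] = [i = j] c_i (omega_i - omega'_i): the
    first letter j of the middle word is the one on which the skew derivations
    in eop i start. *)
Lemma fop_eop i j phi : fop j (eop i phi) = eop i (fop j phi)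
  + ((i == j)%:R * c i) *: (translate (om i) phi - translate (om' i) phi).
Proof.
apply: FnP => g u v.
(* The coefficient 1 puts the sum into the form that FnE evaluates. *)
have -> (V : lmodType K) (x y : V) : x + y = 1 *: x + y by rewrite scale1r.
rewrite /fop /eop FnE !scale1r scalerA mulrC -scalerA.
pose S w := skewder i (chi^~ w) (fun x => phi (g + w) (j :: x) v) u.
have skS w : skewder i (chi^~ w) (fun x => phi (g + w) x v) (j :: u) =
    chi j w *: S w + (i == j)%:R *: phi (g + w) u v by [].
have skS' w : skewder i (chi^~ w) (fun x => chi j (g + w) *: phi (g + w) (j :: x) v) u =
    (chi j g * chi j w) *: S w.
  rewrite chiD (_ : (fun x => _) =
    ((chi j g * chi j w) *: (fun x => phi (g + w) (j :: x) v))) //.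
  exact: linear_mapZ (skewder_linear i _ u).
rewrite !skS !skS' opprD addrACA.
set X := _ - chi j (om' i) *: _; pose A := phi (g + om i) u v.
pose B := phi (g + om' i) u v; rewrite -scalerBr -/A -/B.
have -> : ((i == j)%:R *: (c i *: (translate (om i) phi - translate (om' i) phi)))
    g u v = (i == j)%:R *: (c i *: (A - B)) by [].
rewrite -!(scalerA (chi j g)) -scalerBr -/X (scalerA (c i)) [c i * _]mulrC -!scalerA.
have E x : (chi i g)^-1 *: (chi j g *: (c i *: ((i == j)%:R *: x))) =
    (i == j)%:R *: (c i *: x) :> T.
  have [->|_] := eqVneq i j; last by rewrite !scale0r !scaler0.
  by rewrite !scale1r scalerK ?chi_neq0.
by rewrite !scalerDr !E !addrA.
Qed.

Variable S : seq (K * seq I) -> Prop.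

(** The functionals that factor through the quotients by the ideals generated
    by S, in the last variable, and by the reversals of S, in the middle one. *)
Definition kills (phi : Fn) : Prop := forall q, S q ->
  (forall g a b v, nceval q (fun w => phi g (a ++ rev w ++ b) v) = 0) /\
  (forall g u a b, nceval q (fun w => phi g u (a ++ w ++ b)) = 0).

Hypothesis S_homogeneous : forall q, S q -> homogeneous q.
(* Words are reversed because it is the reversed Serre polynomials that are
   relations between the f_i. *)
Hypothesis S_skew : forall q i (V : lmodType K) (psi : seq I -> V), S q ->
  nceval q (fun w => skewder i (chi^~ (om i)) psi (rev w)) = 0 /\
  nceval q (fun w => skewder i (chi^~ (om' i)) psi (rev w)) = 0.

Lemma kills0 : kills 0.
Proof. by move=> q _; split=> *; apply: nceval0. Qed.

Lemma kills_lin k phi psi : kills phi -> kills psi -> kills (k *: phi + psi).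
Proof.
move=> kphi kpsi q Sq; have [[phi1 phi2] [psi1 psi2]] := (kphi q Sq, kpsi q Sq).
split=> [g a b v|g u a b].
  by under eq_fun do rewrite FnE; rewrite ncevalD ncevalZ phi1 psi1 scaler0 addr0.
by under eq_fun do rewrite FnE; rewrite ncevalD ncevalZ phi2 psi2 scaler0 addr0.
Qed.

(** The only case with content is eop i in the middle variable, where the skew
    derivations must preserve the ideal of the reversals of S. *)
Lemma kills_qop x phi : kills phi -> kills (qop x phi).
Proof.
have killsT h : kills phi -> kills (translate h phi).
  by move=> kphi q /kphi[phi1 phi2]; split=> *; [apply: phi1 | apply: phi2].
case: x => [i|j|i|i|i|i]; try exact: killsT.
  move=> kphi q Sq; have [phi1 phi2] := kphi q Sq.
  split=> [g a b v|g u a b] /=; rewrite /eop ncevalZ ncevalD ncevalZ.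
    rewrite phi1 add0r.
    under eq_fun do rewrite -scaleN1r.
    rewrite ncevalD ncevalZ !nceval_skewder_ideal ?scaler0 ?addr0 ?scaler0 //.
    all: try exact: S_homogeneous.
    all: try by move=> psi; case: (S_skew i psi Sq).
  rewrite (phi2 g u (i :: a)) add0r; under eq_fun do rewrite -scaleN1r.
  have phi0 h : nceval q (fun w x => phi (g + h) x (a ++ w ++ b)) = fun=> 0.
    by apply/funext => x; rewrite nceval_app phi2.
  rewrite ncevalD ncevalZ !nceval_skewder !phi0.
  by rewrite !skewder0 scaler0 addr0 !scaler0.
move=> kphi q /kphi[phi1 phi2]; split=> [g a b v|g u a b] /=; rewrite /fop ncevalZ.
  by rewrite (phi1 g (j :: a)) scaler0.
by rewrite phi2 scaler0.
Qed.

Definition eword (w : seq I) (phi : Fn) : Fn := foldl (fun psi i => eop i psi) phi w.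
Definition fword (w : seq I) (phi : Fn) : Fn := foldl (fun psi i => fop i psi) phi w.

Lemma fwordE w phi g u v :
  fword w phi g u v = (\prod_(j <- w) chi j g) *: phi g (w ++ u) v.
Proof.
elim: w phi u => [|j w IH] phi u; first by rewrite big_nil scale1r.
by rewrite [LHS]IH /fop scalerA big_cons mulrC.
Qed.

Lemma ewordE w phi g v :
  eword w phi g [::] v = (\prod_(j <- w) (chi j g)^-1) *: phi g [::] (w ++ v).
Proof.
elim: w phi => [|j w IH] phi; first by rewrite big_nil scale1r.
by rewrite [LHS]IH /eop /= subrr scaler0 addr0 scalerA big_cons mulrC.
Qed.

(** Transpose of
    [e_w, f_j] = c_j (D e_w * omega_j - D' e_w * omega'_j), where omega_j
    stands on the right and D and D' accumulate weights from the last letter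
    of e_w on; hence the reversal of the word. *)
Lemma fop_eword j w phi : fop j (eword (rev w) phi) = eword (rev w) (fop j phi)
  + c j *: (skewder j (chi^~ (om j)) (fun x => translate (om j) (eword (rev x) phi)) w
      - skewder j (chi^~ (om' j)) (fun x => translate (om' j) (eword (rev x) phi)) w).
Proof.
elim: w => [|i w IH]; first by rewrite /= subrr scaler0 addr0.
have eword_cons x psi : eword (rev (i :: x)) psi = eop i (eword (rev x) psi).
  by rewrite /eword rev_cons foldl_rcons.
rewrite eword_cons fop_eop IH linearD linearZ linearB /= eword_cons.
rewrite !(skewder_comp _ _ _ _ (eop_linear i)) -!addrA; congr (_ + _).
have sk h : skewder j (chi^~ h) (fun x => eop i (translate h (eword (rev x) phi))) w =
  chi i h *: skewder j (chi^~ h) (fun x => translate h (eword (rev (i :: x)) phi)) w.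
  rewrite -(linear_mapZ _ _ (skewder_linear _ _ _)); congr skewder.
  by apply/funext => x; rewrite eop_translate -eword_cons.
have -> : (i == j)%:R * c i = c j * (j == i)%:R.
  by have [->|] := eqVneq i j; rewrite ?mulr1 ?mul1r // mul0r mulr0.
rewrite !sk opprD [_ + (- _ - _)]addrCA -scalerBr addrA [RHS]scalerDr scalerA.
by have [->|_] := eqVneq i j; rewrite // mulr0 !scale0r.
Qed.

(** By induction on the middle word u.  For the empty word, e_w just
    concatenates w to the last word, where phi respects q.  A letter f_j is
    moved across q(e), with which it commutes because the skew derivations
    kill q, and is absorbed into phi. *)
Lemma e_relation q phi : S q -> kills phi -> nceval q (fun w => eword w phi) = 0.
Proof.
move=> Sq kphi; apply: FnP => g u v; rewrite !nceval_app.
elim: u phi kphi v => [|j u IH] phi kphi v.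
  under eq_fun do rewrite ewordE.
  apply: (nceval_weight (wt := fun w => \prod_(j <- w) (chi j g)^-1)).
  - exact: S_homogeneous.
  - by move=> w w'; apply: perm_big.
  by have [_ /(_ g [::] [::] v)] := kphi q Sq.
have com_f : nceval q (fun w => fop j (eword w phi))
    = nceval q (fun w => eword w (fop j phi)).
  under eq_fun do rewrite -[X in eword X]revK fop_eword revK -scaleN1r.
  rewrite ncevalD ncevalZ ncevalD ncevalZ.
  rewrite (S_skew j (fun x => translate (om j) (eword (rev x) phi)) Sq).1.
  rewrite (S_skew j (fun x => translate (om' j) (eword (rev x) phi)) Sq).2.
  by rewrite scaler0 addr0 scaler0 addr0.
apply: (scalerI (chi_neq0 j g)); rewrite scaler0 -ncevalZ.
have /(congr1 (fun F : Fn => F g u v)) := com_f; rewrite !nceval_app => ->.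
exact/IH/(kills_qop (Qf j)).
Qed.

Lemma f_relation q phi : S q -> kills phi -> nceval q (fun w => fword (rev w) phi) = 0.
Proof.
move=> Sq kphi; apply: FnP => g u v; rewrite !nceval_app.
under eq_fun do rewrite fwordE.
apply: (nceval_weight (wt := fun w => \prod_(j <- rev w) chi j g)).
- exact: S_homogeneous.
- by move=> w w' eq_w; rewrite !(perm_big _ (permEl (perm_rev _))) (perm_big _ eq_w).
by have [/(_ g [::] u v)] := kphi q Sq.
Qed.

End Functionals.

(** * Quantum Serre polynomials *)

Section SerrePolynomials.
Variables (K : fieldType) (I : eqType) (p : I -> I -> K).

(** For the weights of omega_i and of omega'_i, both skew derivations at i kill
    the reversal of q; equivalently q(e) commutes with all the f_i, and the
    reversal of q(f) with all the e_i. *)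
Definition skew_null (q : seq (K * seq I)) : Prop :=
  forall i (V : lmodType K) (psi : seq I -> V),
    nceval q (fun w => skewder i (p^~ i) psi (rev w)) = 0 /\
    nceval q (fun w => skewder i (fun k => (p i k)^-1) psi (rev w)) = 0.

Lemma lin2_eq0 (V : lmodType K) (a b : K) (x y : V) :
  a = 0 -> b = 0 -> a *: x + b *: y = 0.
Proof. by move=> -> ->; rewrite !scale0r addr0. Qed.

Lemma lin3_eq0 (V : lmodType K) (a b d : K) (x y z : V) :
  a = 0 -> b = 0 -> d = 0 -> a *: x + b *: y + d *: z = 0.
Proof. by move=> -> -> ->; rewrite !scale0r !addr0. Qed.

Lemma skew_null_comm x y c : x != y -> c != 0 -> p y x = c -> p x y = c^-1 ->
  skew_null [:: (1, [:: x; y]); (- c, [:: y; x])].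
Proof.
move=> neq_xy c0 pyx pxy i V psi; rewrite /nceval !big_cons !big_nil /rev /=.
have [->|neq_ix] := eqVneq i x.
  rewrite !(negPf neq_xy) pyx pxy invrK; split.
    by rewrite !(scaler0, scale0r, scale1r, addr0, add0r) scaleNr subrr.
  by rewrite !(scaler0, scale0r, scale1r, addr0, add0r) scaleNr subrr.
have [->|neq_iy] := eqVneq i y; last first.
  by rewrite !(scaler0, scale0r, addr0).
rewrite pyx pxy; split.
  by rewrite !(scaler0, scale0r, scale1r, addr0, add0r) scalerA mulNr divff // scaleN1r subrr.
by rewrite !(scaler0, scale0r, scale1r, addr0, add0r) scalerA mulNr divff // scaleN1r subrr.
Qed.

Lemma quadratic_skew_l (V : lmodType K) (rho : I -> K) (psi : seq I -> V) x y a b :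
    x != y -> a != 0 -> rho y = a -> rho x = b / a ->
  nceval [:: (1, [:: x; x; y]); (- (a + b), [:: x; y; x]); (a * b, [:: y; x; x])]
    (fun w => skewder x rho psi (rev w)) = 0.
Proof.
move=> neq_xy a0 rhoy rhox; rewrite /nceval !big_cons !big_nil /rev /=.
rewrite !eqxx !(negPf neq_xy) rhoy rhox !(scaler0, scale0r, scale1r, addr0, add0r).
(* Terms 1, 2, 4 are multiples of psi [:: y; x], the others of psi [:: x; y]. *)
rewrite !scalerDr !scalerA !addrA [LHS](ACl ((1*2*4)*(3*5*6))) /= -!scalerDl.
by apply: lin2_eq0; field.
Qed.

Lemma quadratic_skew_r (V : lmodType K) (rho : I -> K) (psi : seq I -> V) x y a b :
    x != y -> b != 0 -> rho x = b^-1 ->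
  nceval [:: (1, [:: x; x; y]); (- (a + b), [:: x; y; x]); (a * b, [:: y; x; x])]
    (fun w => skewder y rho psi (rev w)) = 0.
Proof.
rewrite eq_sym => neq_xy b0 rhox; rewrite /nceval !big_cons !big_nil /rev /=.
rewrite !eqxx !(negPf neq_xy) rhox !(scaler0, scale0r, scale1r, addr0, add0r).
rewrite -[X in X + _]scale1r !scalerA -!scalerDl -[RHS](scale0r (psi [:: x; x])).
by congr (_ *: _); field.
Qed.

Lemma skewder_notin (V : lmodType K) (rho : I -> K) i w (psi : seq I -> V) :
  i \notin w -> skewder i rho psi w = 0.
Proof.
elim: w psi => //= j w IH psi; rewrite inE negb_or => /andP[/negPf-> iw].
by rewrite IH // scaler0 scale0r addr0.
Qed.

Lemma nceval_skewder_notin (V : lmodType K) (rho : I -> K) i q (psi : seq I -> V) :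
  all (fun t => i \notin t.2) q -> nceval q (fun w => skewder i rho psi (rev w)) = 0.
Proof.
move=> /allP q_i; rewrite /nceval big_seq big1 // => t /q_i it.
by rewrite skewder_notin ?scaler0 // mem_rev.
Qed.

(** The conditions are symmetric under exchanging a with b together with the
    weights of omega with those of omega', so that both skew derivations are
    covered by one computation for x and one for y. *)
Lemma skew_null_quadratic x y a b : x != y -> a != 0 -> b != 0 ->
    p y x = a -> p x y = b^-1 -> p x x = b / a ->
  skew_null [:: (1, [:: x; x; y]); (- (a + b), [:: x; y; x]); (a * b, [:: y; x; x])].
Proof.
move=> neq_xy a0 b0 pyx pxy pxx i V psi.
have [->|neq_ix] := eqVneq i x.
  split; first exact: quadratic_skew_l.
  rewrite [a + b]addrC [a * b]mulrC; apply: quadratic_skew_l => //.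
    by rewrite pxy invrK.
  by rewrite pxx invf_div.
have [->|neq_iy] := eqVneq i y.
  split; first exact: quadratic_skew_r.
  rewrite [a + b]addrC [a * b]mulrC; apply: quadratic_skew_r => //.
  by rewrite pyx.
by split; apply: nceval_skewder_notin; rewrite /= !inE (negPf neq_ix) (negPf neq_iy).
Qed.

(** x^3 y - e1 x^2 y x + e2 x y x^2 - e3 y x^3, for the elementary symmetric
    functions e1, e2, e3 of a, m, b.  As m^2 = a b, e2 = m e1 and e3 = m^3. *)
Definition geometric_cubic (x y : I) (a m b : K) : seq (K * seq I) :=
  let e := a + m + b in
  [:: (1, [:: x; x; x; y]); (- e, [:: x; x; y; x]);
      (m * e, [:: x; y; x; x]); (- m ^+ 3, [:: y; x; x; x])].

Lemma cubic_skew_l (V : lmodType K) (rho : I -> K) (psi : seq I -> V) x y a m b :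
    x != y -> a != 0 -> m != 0 -> m ^+ 2 = a * b -> rho y = a -> rho x = m / a ->
  nceval (geometric_cubic x y a m b) (fun w => skewder x rho psi (rev w)) = 0.
Proof.
move=> neq_xy a0 m0 def_b rhoy rhox; rewrite /nceval !big_cons !big_nil /rev /=.
rewrite !eqxx !(negPf neq_xy) rhoy rhox !(scaler0, scale0r, scale1r, addr0, add0r).
have {def_b} -> : b = m ^+ 2 / a by rewrite def_b mulrC mulKf.
rewrite !scalerDr !scalerA !addrA.
(* The three groups are the multiples of psi [:: y; x; x], psi [:: x; y; x] and
   psi [:: x; x; y]. *)
rewrite [LHS](ACl ((1*2*3*6)*(4*5*8*9)*(7*10*11*12))) /= -!scalerDl.
by apply: lin3_eq0; field.
Qed.

Lemma cubic_skew_r (V : lmodType K) (rho : I -> K) (psi : seq I -> V) x y a m b :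
    x != y -> a != 0 -> m != 0 -> m ^+ 2 = a * b -> rho x = b^-1 ->
  nceval (geometric_cubic x y a m b) (fun w => skewder y rho psi (rev w)) = 0.
Proof.
rewrite eq_sym => neq_xy a0 m0 def_b rhox; rewrite /nceval !big_cons !big_nil /rev /=.
rewrite !eqxx !(negPf neq_xy) rhox !(scaler0, scale0r, scale1r, addr0, add0r).
have {def_b} -> : b = m ^+ 2 / a by rewrite def_b mulrC mulKf.
rewrite -[X in X + _]scale1r !scalerA -!scalerDl -[RHS](scale0r (psi [:: x; x; x])).
by congr (_ *: _); field; apply/andP.
Qed.

Lemma skew_null_cubic x y a m b : x != y -> a != 0 -> b != 0 ->
    m ^+ 2 = a * b -> p y x = a -> p x y = b^-1 -> p x x = m / a ->
  skew_null (geometric_cubic x y a m b).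
Proof.
move=> neq_xy a0 b0 def_b pyx pxy pxx i V psi.
have m0 : m != 0 by rewrite -sqrf_eq0 def_b mulf_neq0.
have cubicC : geometric_cubic x y a m b = geometric_cubic x y b m a.
  by rewrite /geometric_cubic [a + m + b](ACl (3*2*1)).
have def_b' : m ^+ 2 = b * a by rewrite mulrC.
have [->|neq_ix] := eqVneq i x.
  split; first exact: cubic_skew_l.
  rewrite cubicC; apply: cubic_skew_l => //.
    by rewrite pxy invrK.
  by rewrite pxx invf_div; apply/eqP; rewrite eqr_div // -expr2 def_b.
have [->|neq_iy] := eqVneq i y.
  split; first exact: cubic_skew_r.
  by rewrite cubicC; apply: cubic_skew_r => //; rewrite pyx.
by split; apply: nceval_skewder_notin; rewrite /= !inE (negPf neq_ix) (negPf neq_iy).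
Qed.

End SerrePolynomials.

(** * Structure constants *)

Section StructureConstants.
Variable n : nat.
Local Notation ip := (@ip n).
Local Notation eps := (eps n).

Lemma ipC x y : ip x y = ip y x.
Proof. by apply: eq_bigr => k _; rewrite mulrC. Qed.

Lemma ipDr x y z : ip x (y + z) = ip x y + ip x z.
Proof. by rewrite -big_split; apply: eq_bigr => k _; rewrite mxE mulrDr. Qed.

Lemma ipBr x y z : ip x (y - z) = ip x y - ip x z.
Proof.
by rewrite -sumrB; apply: eq_bigr => k _; rewrite !mxE mulrBr.
Qed.

Lemma ip_eps a b : ip (eps a) (eps b) = ((a == b) && (0 < a <= n)%N)%:Z.
Proof.
have [/andP[]|a_out] := boolP (0 < a <= n)%N; last first.
  rewrite andbF /Defs.ip big1 // => k _; rewrite !mxE.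
  by rewrite (_ : k.+1 == a = false) ?mul0r //; have := ltn_ord k; lia.
case: a => // a _ lt_an; rewrite andbT /Defs.ip (bigD1 (Ordinal lt_an)) //=.
rewrite !mxE eqxx mul1r big1 ?addr0 // => k /negPf neq_k.
by rewrite !mxE eqSS (_ : k == a :> nat = false) ?mul0r.
Qed.

Lemma ip_eps_root ty i j : (0 < j)%N -> (i < n)%N ->
  ip (eps j) (simple_root ty n i) = (j == i)%:Z - (j == i.+1)%:Z.
Proof.
move=> j0 lt_in; rewrite /simple_root lt_in ipBr !ip_eps.
by congr (Posz (nat_of_bool _) - Posz (nat_of_bool _)); lia.
Qed.

Lemma ip_eps_root_last ty j : (1 < n)%N -> (0 < j)%N ->
  ip (eps j) (simple_root ty n n) =
  match ty with
  | TypeA => 0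
  | TypeB => (j == n)%:Z
  | TypeC => (j == n)%:Z + (j == n)%:Z
  | TypeD => (j == n.-1)%:Z + (j == n)%:Z
  end.
Proof.
move=> n1 j0; rewrite /simple_root ltnn; case: ty.
- by rewrite /Defs.ip big1 // => k _; rewrite [X in _ * X]mxE mulr0.
- by rewrite ip_eps; congr (Posz (nat_of_bool _)); lia.
- by rewrite mulr2n ipDr !ip_eps; congr (Posz (nat_of_bool _) + Posz (nat_of_bool _)); lia.
- by rewrite ipDr !ip_eps; congr (Posz (nat_of_bool _) + Posz (nat_of_bool _)); lia.
Qed.

Variables (K : fieldType) (r s : K).
Local Notation p ty i j := (struct_const ty n r s i j).

(** In type B the structure constants involve the doubled inner product. *)
Definition long_exp (ty : lie_type) : nat := if ty is TypeB then 2 else 1.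

Lemma struct_const_lt ty i j : (0 < j)%N -> (i < n)%N -> (j < n)%N ->
  p ty i j = r ^ ((long_exp ty)%:Z * ((j == i)%:Z - (j == i.+1)%:Z)) *
             s ^ ((long_exp ty)%:Z * ((j.+1 == i)%:Z - (j == i)%:Z)).
Proof.
move=> j0 lt_in lt_jn; rewrite /struct_const lt_jn !ip_eps_root //.
by rewrite eqSS; case: ty; rewrite /= ?mul1r.
Qed.

Section Values.
Variable ty : lie_type.
Local Notation R := (r ^+ long_exp ty).
Local Notation S := (s ^+ long_exp ty).

Lemma struct_const_diag i : (0 < i < n)%N -> p ty i i = R / S.
Proof.
case/andP=> i0 lt_in; rewrite struct_const_lt // eqxx.
have [-> ->] : (i == i.+1) = false /\ (i.+1 == i) = false by split; lia.
by rewrite subr0 sub0r mulr1 mulrN1 exprnN.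
Qed.

Lemma struct_const_next i : (0 < i)%N -> (i.+1 < n)%N -> p ty i i.+1 = R^-1.
Proof.
move=> i0 lt_in; rewrite struct_const_lt ?(ltnW lt_in) // eqxx.
have [-> ->] : (i.+1 == i) = false /\ (i.+2 == i) = false by split; lia.
by rewrite subrr sub0r mulr0 mulrN1 exprnN expr0z mulr1.
Qed.

Lemma struct_const_prev i : (0 < i)%N -> (i.+1 < n)%N -> p ty i.+1 i = S.
Proof.
move=> i0 lt_in; rewrite struct_const_lt ?(ltnW lt_in) // eqxx.
have [-> ->] : (i == i.+1) = false /\ (i == i.+2) = false by split; lia.
by rewrite subrr subr0 mulr0 mulr1 expr0z mul1r.
Qed.

Lemma struct_const_far i j : (0 < i < n)%N -> (0 < j < n)%N ->
  (i.+1 < j)%N || (j.+1 < i)%N -> p ty i j = 1.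
Proof.
move=> /andP[i0 lt_in] /andP[j0 lt_jn] far; rewrite struct_const_lt //.
have [-> -> ->] : [/\ (j == i) = false, (j == i.+1) = false & (j.+1 == i) = false].
  by split; lia.
by rewrite subrr !mulr0 !expr0z mulr1.
Qed.

End Values.

Hypothesis n1 : (1 < n)%N.

Let n0 : (0 < n)%N := ltnW n1.
Let n'0 : (0 < n.-1)%N. Proof. by lia. Qed.
Let n'lt : (n.-1 < n)%N. Proof. by lia. Qed.
Let n'S : n.-1.+1 = n. Proof. by lia. Qed.
Let n'neq : (n.-1 == n) = false. Proof. by lia. Qed.
Let nneq' : (n == n.-1) = false. Proof. by lia. Qed.

Lemma struct_const_B : [/\ p TypeB n n = r / s, p TypeB n.-1 n = r ^- 2
  & p TypeB n n.-1 = s ^+ 2].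
Proof.
split; rewrite /struct_const ?ltnn ?n'lt // ?n'S ?(ip_eps_root _ n0 n'lt) ?n'S ?eqxx ?nneq'.
  by rewrite sub0r mulrN1 exprnN.
by rewrite !ip_eps_root_last // !eqxx n'neq mulr0 mulr1 expr0z mul1r.
Qed.

Lemma struct_const_C : [/\ p TypeC n n = r ^+ 2 / s ^+ 2, p TypeC n.-1 n = r ^- 2
  & p TypeC n n.-1 = s ^+ 2].
Proof.
split; rewrite /struct_const ?ltnn ?n'lt // ?n'S ?(ip_eps_root _ n0 n'lt) ?n'S ?eqxx ?nneq'.
  by rewrite sub0r mulrN1 exprnN.
by rewrite !ip_eps_root_last // !eqxx n'neq addr0 expr0z mul1r.
Qed.

Lemma struct_const_BC_far ty j : ty = TypeB \/ ty = TypeC -> (0 < j)%N -> (j.+1 < n)%N ->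
  p ty j n = 1 /\ p ty n j = 1.
Proof.
move=> tyBC j0 lt_jn; have lt_jn' := ltnW lt_jn.
have [nj nj1] : (n == j) = false /\ (n == j.+1) = false by split; lia.
have [jn j1n] : (j == n) = false /\ (j.+1 == n) = false by split; lia.
rewrite /struct_const; split.
  by case: tyBC => ->; rewrite ltnn lt_jn' ip_eps_root // nj nj1 subrr mulr0 expr0z.
by case: tyBC => ->; rewrite lt_jn' !ip_eps_root_last // jn j1n ?addr0 ?mulr0 !expr0z mulr1.
Qed.

Lemma struct_const_D : [/\ p TypeD n n = r / s, p TypeD n.-1 n = (r * s)^-1
  & p TypeD n n.-1 = r * s].
Proof.
split; rewrite /struct_const ?ltnn ?n'lt ?eqxx ?nneq' ?n'S.
- by rewrite /= !ip_eps_root_last // !eqxx n'neq nneq' addr0 add0r.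
- by rewrite /= invfM.
- by rewrite !ip_eps_root_last // !eqxx n'neq nneq' addr0 add0r.
Qed.

Lemma struct_const_D_far j : (0 < j)%N -> (j.+1 < n)%N ->
  if j.+2 == n then p TypeD j n = r^-1 /\ p TypeD n j = s
  else p TypeD j n = 1 /\ p TypeD n j = 1.
Proof.
move=> j0 lt_jn; have lt_jn' := ltnW lt_jn.
rewrite /struct_const ltnn lt_jn' (_ : j != n.-1); last by lia.
rewrite !(ip_eps_root _ _ lt_jn') // !ip_eps_root_last //.
have -> : (n.-1 == j) = false by lia.
have -> : (n == j) = false by lia.
have -> : (n == j.+1) = false by lia.
have -> : (j == n.-1) = false by lia.
have -> : (j == n) = false by lia.
have -> : (j.+1 == n) = false by lia.
have -> : (n.-1 == j.+1) = (j.+2 == n) by lia.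
have -> : (j.+1 == n.-1) = (j.+2 == n) by lia.
by case: (j.+2 == n); split;
  rewrite /= !(subrr, subr0, sub0r, oppr0, addr0, add0r, expr0z, mulr1, mul1r).
Qed.

End StructureConstants.

Section Cartan.
Variable n : nat.
Local Notation ip := (@ip n).
Local Notation root ty i := (simple_root ty n i).

Lemma ip_root ty i x : (i < n)%N ->
  ip (root ty i) x = ip (eps n i) x - ip (eps n i.+1) x.
Proof. by move=> lt_in; rewrite {1}/simple_root lt_in ipC ipBr !(ipC x). Qed.

Lemma ip_root_self ty i : (0 < i < n)%N -> ip (root ty i) (root ty i) = 2.
Proof.
case/andP=> i0 lt_in; rewrite ip_root // !ip_eps_root // !eqxx.
by have [-> ->] : (i == i.+1) = false /\ (i.+1 == i) = false by split; lia.
Qed.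

Lemma half_length_B ty i : ty = TypeB -> (0 < i < n)%N -> half_length ty n i = 2.
Proof. by move=> ->; apply: ip_root_self. Qed.

Lemma cartan_row ty i j : (0 < i < n)%N ->
  cartan ty n i j = ip (eps n i) (root ty j) - ip (eps n i.+1) (root ty j).
Proof.
move=> lt_in; rewrite /cartan ip_root_self // mulKz // ip_root //.
by case/andP: lt_in.
Qed.

Lemma cartan_lt ty i j : (0 < i < n)%N -> (0 < j < n)%N ->
  cartan ty n i j = ((i == j) + (i == j))%N%:Z - ((i == j.+1) + (i.+1 == j))%N%:Z.
Proof.
move=> lt_in /andP[j0 lt_jn]; have /andP[i0 _] := lt_in.
by rewrite cartan_row // !ip_eps_root // eqSS; lia.
Qed.

Lemma cartan_D_last i : (0 < i < n)%N -> cartan TypeD n i n = - (i.+2 == n)%:Z.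
Proof.
move=> lt_in; have /andP[i0 _] := lt_in.
by rewrite cartan_row // !ip_eps_root_last //; lia.
Qed.

Lemma cartan_D_last_row j : (0 < j < n)%N -> cartan TypeD n n j = - (j.+2 == n)%:Z.
Proof.
case/andP=> j0 lt_jn; have n1 : (1 < n)%N by lia.
have ip_n x : ip (root TypeD n) x = ip (eps n n.-1) x + ip (eps n n) x.
  by rewrite {1}/simple_root ltnn ipC ipDr !(ipC x).
have -> : cartan TypeD n n j = ip (root TypeD n) (root TypeD j).
  rewrite /cartan [X in (_ %/ X)%Z](_ : _ = 2) ?mulKz //.
  by rewrite ip_n !ip_eps_root_last //; lia.
by rewrite ip_n !ip_eps_root //; lia.
Qed.

End Cartan.

Section Indices.
Variables (ty : lie_type) (n : nat).
Hypothesis n_adm : admissible ty n.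
Local Notation I := 'I_(lie_rank ty n).

Lemma num_gt0 (i : I) : (0 < num i)%N. Proof. by []. Qed.

Lemma num_bound (i : I) : (if ty is TypeA then num i < n else num i <= n)%N.
Proof.
rewrite /num; have := ltn_ord i; move: (nat_of_ord i) => k; move: n_adm.
by rewrite /lie_rank; case: ty => /=; lia.
Qed.

Lemma num_le (i : I) : (num i <= n)%N.
Proof. by apply: leq_trans (ltn_ord i) _; rewrite /lie_rank; case: ty; lia. Qed.

Lemma n_gt1 : (1 < n)%N.
Proof. by move: n_adm; case: ty => /=; lia. Qed.

End Indices.

Section SerreRelations.
Variables (K : fieldType) (r s : K) (ty : lie_type) (n : nat).
Hypotheses (n_adm : admissible ty n) (r0 : r != 0) (s0 : s != 0).
Local Notation I := 'I_(lie_rank ty n).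
Local Notation p i j := (struct_const ty n r s i j).
Local Notation serre := (@serre K r s ty n).

Lemma serre_homogeneous q : serre q -> homogeneous q.
Proof.
have homP (t0 : K * seq I) q' :
    all (fun t => perm_eq t.2 t0.2) q' -> homogeneous (t0 :: q').
  move=> /allP q'w; have tw t : t \in t0 :: q' -> perm_eq t.2 t0.2.
    by rewrite inE => /predU1P[->//|/q'w].
  move=> t t' /tw t_w /tw t'_w; apply: perm_trans t_w _.
  by rewrite perm_sym.
have permI (u v : seq I) : (forall a, count a u = count a v) -> perm_eq u v.
  by move=> eq_uv; apply/seq.permP.
by case=> *; apply: homP; rewrite /= !permI // => a /=; lia.
Qed.

Lemma struct_const_far_comm i j : ty <> TypeD -> (0 < i)%N -> (0 < j)%N ->
    (if ty is TypeA then maxn i j < n else maxn i j <= n)%N ->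
    (i.+1 < j)%N || (j.+1 < i)%N ->
  p i j = 1 /\ p j i = 1.
Proof.
move=> tyD i0 j0 le_n far; have n1 := n_gt1 n_adm.
have [lt_n|ge_n] := ltnP (maxn i j) n.
  by split; apply: struct_const_far; lia.
have tyBC : ty = TypeB \/ ty = TypeC.
  by case: ty le_n tyD => //; [lia | left | right].
have max_n : maxn i j = n by case: ty tyBC le_n => [|||] [//|//]; lia.
have [j_n|i_n] : j = n \/ i = n by lia.
  by rewrite j_n; apply: struct_const_BC_far => //; lia.
by rewrite i_n and_comm; apply: struct_const_BC_far => //; lia.
Qed.

Lemma struct_const_D_comm i j : ty = TypeD -> (0 < i)%N -> (0 < j)%N ->
    (i <= n)%N -> (j <= n)%N -> i != j -> cartan ty n i j = 0 ->
    ~~ ((i == n.-1) && (j == n) || (i == n) && (j == n.-1)) ->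
  p i j = 1 /\ p j i = 1.
Proof.
move=> tyD i0 j0 le_in le_jn neq_ij a_ij not_last; have n1 := n_gt1 n_adm.
have [lt_n|ge_n] := ltnP (maxn i j) n.
  by move: a_ij; rewrite cartan_lt; try lia; split; apply: struct_const_far; lia.
have far k : (0 < k)%N -> (k.+1 < n)%N -> k.+2 != n -> p k n = 1 /\ p n k = 1.
  move=> k0 lt_k neq_k; have := struct_const_D_far r s n1 k0 lt_k.
  by rewrite (negPf neq_k) tyD.
move: a_ij; have [j_n|i_n] : j = n \/ i = n by lia.
  rewrite j_n tyD cartan_D_last; last by lia.
  by move=> a_ij; rewrite -tyD; apply: far; lia.
rewrite i_n tyD cartan_D_last_row; last by lia.
by move=> a_ij; rewrite and_comm -tyD; apply: far; lia.
Qed.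

(** In type D such an edge may join n - 2 and n, where p is given by a formula
    of its own; the values are the same as along the chain. *)
Lemma struct_const_AD_edge i j : ty = TypeA \/ ty = TypeD -> (0 < i)%N -> (i < j)%N ->
    (if ty is TypeA then j < n else j <= n)%N -> cartan ty n i j = - 1 ->
  [/\ p i i = r / s, p j j = r / s, p i j = r^-1 & p j i = s].
Proof.
move=> tyAD i0 lt_ij le_jn a_ij; have n1 := n_gt1 n_adm.
have long1 : long_exp ty = 1%N by case: tyAD => ->.
have diag k : (0 < k < n)%N -> p k k = r / s.
  by move=> lt_kn; rewrite struct_const_diag // long1.
have [lt_jn|ge_jn] := ltnP j n.
  move: a_ij; rewrite cartan_lt; try lia; move=> a_ij.
  have ->: j = i.+1 by lia.
  split; try by apply: diag; lia.
    by rewrite struct_const_next // ?long1 //; lia.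
  by rewrite struct_const_prev // ?long1 //; lia.
have tyD : ty = TypeD by case: tyAD => // tyA; move: le_jn; rewrite tyA; lia.
have j_n : j = n by move: le_jn; rewrite tyD; lia.
move: a_ij diag; rewrite j_n tyD cartan_D_last; last by lia.
move=> a_ij diag; have [pnn _ _] := struct_const_D r s n1.
have := struct_const_D_far r s n1 i0; rewrite (_ : i.+2 == n); last by lia.
by case=> [|pin pni]; [lia | split=> //; apply: diag; lia].
Qed.

Lemma struct_const_B_edge i : ty = TypeB -> (0 < i)%N -> (i < n)%N ->
  [/\ p i i = r ^+ 2 / s ^+ 2, p i i.+1 = r ^- 2 & p i.+1 i = s ^+ 2].
Proof.
move=> tyB i0 lt_in; have i_n : (0 < i < n)%N by lia.
have {i_n} pii := struct_const_diag r s ty i_n.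
have [lt_i1n|ge_n] := ltnP i.+1 n.
  have pij := struct_const_next r s ty i0 lt_i1n.
  have pji := struct_const_prev r s ty i0 lt_i1n.
  by move: pii pij pji; rewrite tyB.
have [_ pij pji] := struct_const_B r s (n_gt1 n_adm); have i_n : i = n.-1 by lia.
have S_n : n.-1.+1 = n by lia.
by move: pii; rewrite tyB i_n S_n.
Qed.

(** In every case the numbers a and b passed to the two lemmas on Serre
    polynomials are p_yx and 1/p_xy, and the relation expresses p_xx through
    them: p_xx is b/a for a quadratic relation, m/a = b/m for a cubic one. *)
Lemma serre_skew_null q : serre q ->
  skew_null (fun i j : I => p (num i) (num j)) q.
Proof.
have n1 := n_gt1 n_adm; have ri0 k : r ^- k != 0 by rewrite invr_eq0 expf_neq0.
have si0 k : s ^- k != 0 by rewrite invr_eq0 expf_neq0.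
have neqS (i j : I) : num j = (num i).+1 -> i != j.
  by move=> def_j; apply: contra_eq_neq def_j => ->; lia.
have neq_lt (i j : I) : (num i < num j)%N -> i != j.
  by move=> lt_ij; apply: contraTneq lt_ij => ->; rewrite ltnn.
have commP i j : i != j -> p (num i) (num j) = 1 /\ p (num j) (num i) = 1 ->
    skew_null (fun i j : I => p (num i) (num j)) (nc_comm K i j).
  by move=> neq_ij [pij pji]; apply: skew_null_comm; rewrite ?oner_neq0 ?invr1.
have le_max a b : (if ty is TypeA then a < n else a <= n)%N ->
    (if ty is TypeA then b < n else b <= n)%N ->
    (if ty is TypeA then maxn a b < n else maxn a b <= n)%N.
  by case: ty; lia.
case=> {q}.
- move=> i j tyD far; apply: commP.
    by apply: contraTneq far => ->; lia.
  apply: struct_const_far_comm => //.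
  exact: le_max (num_bound n_adm i) (num_bound n_adm j).
- move=> i j tyD neq_ij a_ij not_last; apply: commP => //.
  by apply: struct_const_D_comm => //; apply: num_le.
- move=> i j tyD i_n j_n; have [_ pij pji] := struct_const_D r s n1.
  by apply: skew_null_comm; rewrite ?mulf_neq0 ?i_n ?j_n ?tyD //; apply: neq_lt; lia.
- move=> i j tyAD lt_ij a_ij; have := num_bound n_adm j => le_jn.
  have [pii pjj pij pji] := struct_const_AD_edge tyAD (num_gt0 i) lt_ij le_jn a_ij.
  by rewrite [r + s]addrC [r * s]mulrC; apply: skew_null_quadratic => //; apply: neq_lt.
- move=> i j tyAD lt_ij a_ij; have := num_bound n_adm j => le_jn.
  have [pii pjj pij pji] := struct_const_AD_edge tyAD (num_gt0 i) lt_ij le_jn a_ij.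
  apply: skew_null_quadratic; rewrite ?invr_eq0 ?invrK //.
    by rewrite eq_sym neq_lt.
  by rewrite pjj mulrC.
- move=> i j tyB lt_in j_i; have [pii pij pji] := struct_const_B_edge tyB (num_gt0 i) lt_in.
  have -> : ri ty n r (num i) = r ^+ 2 by rewrite /ri half_length_B.
  have -> : si ty n s (num i) = s ^+ 2 by rewrite /si half_length_B.
  rewrite addrC mulrC; apply: skew_null_quadratic; rewrite ?expf_neq0 ?j_i //.
  exact: neqS.
- move=> i j tyB lt_in j_i.
  have lt_in' : (num i < n)%N by lia.
  have lt_jn : (num j < n)%N by lia.
  have [pii pij pji] := struct_const_B_edge tyB (num_gt0 i) lt_in'.
  have [pjj _ _] := struct_const_B_edge tyB (num_gt0 j) lt_jn.
  have -> : ri ty n r (num j) = r ^+ 2 by rewrite /ri half_length_B.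
  have -> : si ty n s (num j) = s ^+ 2 by rewrite /si half_length_B.
  apply: skew_null_quadratic; rewrite ?invrK ?ri0 ?si0 //.
  + by rewrite eq_sym neqS.
  + by rewrite j_i.
  + by rewrite j_i.
  by rewrite pjj mulrC.
- move=> i j tyB i_n j_n /=; set c := _ + _.
  have [pnn pin pni] := struct_const_B r s n1.
  rewrite (_ : nc_cubic _ _ _ _ _ =
    geometric_cubic j i (r ^- 2) (r^-1 * s^-1) (s ^- 2)); last first.
    by rewrite /nc_cubic /geometric_cubic exprMn !exprVn.
  apply: skew_null_cubic; rewrite // ?i_n ?j_n ?tyB ?invrK //.
  + by rewrite eq_sym; apply: neq_lt; lia.
  + by rewrite exprMn !exprVn.
  by rewrite pnn; field; apply/andP.
- move=> i j tyC lt_in j_i; have e1 : long_exp ty = 1%N by rewrite tyC.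
  have lt_jn : ((num i).+1 < n)%N by lia.
  have i_n : (0 < num i < n)%N by rewrite num_gt0; lia.
  have pii := struct_const_diag r s ty i_n.
  have pij := struct_const_next r s ty (num_gt0 i) lt_jn.
  have pji := struct_const_prev r s ty (num_gt0 i) lt_jn.
  rewrite [r + s]addrC [r * s]mulrC; apply: skew_null_quadratic => //.
  + exact: neqS.
  + by rewrite j_i pji e1.
  + by rewrite j_i pij e1.
  by rewrite pii e1 !expr1.
- move=> i j tyC lt_in j_i; have e1 : long_exp ty = 1%N by rewrite tyC.
  have lt_jn : ((num i).+1 < n)%N by lia.
  have j_n : (0 < num j < n)%N by rewrite num_gt0; lia.
  have pjj := struct_const_diag r s ty j_n.
  have pij := struct_const_next r s ty (num_gt0 i) lt_jn.
  have pji := struct_const_prev r s ty (num_gt0 i) lt_jn.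
  apply: skew_null_quadratic; rewrite ?invr_eq0 //.
  + by rewrite eq_sym neqS.
  + by rewrite j_i pij e1.
  + by rewrite j_i pji e1 invrK.
  by rewrite pjj e1 !expr1 mulrC invrK.
- move=> i j tyC i_n j_n /=; set c := _ + _.
  have [pnn pin pni] := struct_const_C r s n1.
  rewrite (_ : nc_cubic _ _ _ _ _ = geometric_cubic i j (s ^+ 2) (r * s) (r ^+ 2)); last first.
    by rewrite /nc_cubic /geometric_cubic /c [r ^+ 2 + _ + _](ACl (3*2*1)).
  apply: skew_null_cubic; rewrite ?expf_neq0 // ?i_n ?j_n ?tyC //.
  + by apply: neq_lt; lia.
  + by rewrite exprMn mulrC.
  rewrite struct_const_diag; last by lia.
  by rewrite /long_exp; field.
- move=> i j tyC i_n j_n; have [pnn pin pni] := struct_const_C r s n1.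
  apply: skew_null_quadratic; rewrite ?ri0 ?si0 ?i_n ?j_n ?tyC ?invrK //.
    by rewrite eq_sym; apply: neq_lt; lia.
  by rewrite pnn mulrC.
Qed.

End SerreRelations.

(** * Laurent monomials and generated subalgebras *)

Section Laurent.
Variables (K : fieldType) (A : algType K) (J : finType) (x xi : J -> A).
Hypothesis x_inv : forall j, x j * xi j = 1 /\ xi j * x j = 1.
Hypothesis x_comm : forall i j, x i * x j = x j * x i.
Local Notation G := {ffun J -> int}.
Local Notation mon := (laurent_monomial x xi).

Definition unit_exponent (j : J) : G := [ffun i => (i == j)%:Z].

Lemma zpowS (u ui : A) a : ui * u = 1 -> zpow u ui (a + 1) = zpow u ui a * u.
Proof.
case: a => [m|[|m]] uiu.
- by rewrite -PoszD addn1 /= exprSr.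
- by rewrite /= expr1 uiu.
have -> : Negz m.+1 + 1 = Negz m by rewrite !NegzE; lia.
by rewrite /= [in RHS]exprSr -mulrA uiu mulr1.
Qed.

Lemma zpowD (u ui : A) a b : u * ui = 1 -> ui * u = 1 ->
  zpow u ui (a + b) = zpow u ui a * zpow u ui b.
Proof.
move=> uui uiu.
have zpowP c : zpow u ui (c - 1) = zpow u ui c * ui.
  by rewrite -[in RHS](subrK 1 c) zpowS // -mulrA uui mulr1.
elim/int_rec: b => [|b IH|b IH]; first by rewrite addr0 mulr1.
  by rewrite -addn1 PoszD addrA !zpowS // IH mulrA.
by rewrite -addn1 PoszD opprD addrA !zpowP IH mulrA.
Qed.

Lemma zpow_comm (u ui v : A) a : u * ui = 1 -> ui * u = 1 -> GRing.comm v u ->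
  GRing.comm v (zpow u ui a).
Proof.
move=> uui uiu uv; case: a => m /=; apply: commrX => //.
rewrite /GRing.comm -[LHS]mul1r -{1}uiu -!mulrA (mulrA u) -uv -!mulrA uui.
by rewrite mulr1.
Qed.

Lemma zpow_comm2 i j a b : GRing.comm (zpow (x i) (xi i) a) (zpow (x j) (xi j) b).
Proof.
have [[xi1 xi2] [xj1 xj2]] := (x_inv i, x_inv j).
by apply: zpow_comm => //; apply/commr_sym; apply: zpow_comm => //; apply: x_comm.
Qed.

Lemma laurentD a b : mon (a + b) = mon a * mon b.
Proof.
rewrite /laurent_monomial -prodrM_comm => [|i j _ _]; last exact: zpow_comm2.
by apply: eq_bigr => j _; rewrite ffunE; have [? ?] := x_inv j; apply: zpowD.
Qed.

Lemma laurent0 : mon 0 = 1.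
Proof. by rewrite /laurent_monomial big1 // => j _; rewrite ffunE. Qed.

Lemma laurent_unit j : mon (unit_exponent j) = x j.
Proof.
rewrite /laurent_monomial -[RHS](big_pred1_eq *%R j) [RHS]big_mkcond.
by apply: eq_bigr => i _; rewrite ffunE; case: eqP => //= ->.
Qed.

Lemma laurentN_unit j : mon (- unit_exponent j) = xi j.
Proof.
rewrite /laurent_monomial -[RHS](big_pred1_eq *%R j) [RHS]big_mkcond.
by apply: eq_bigr => i _; rewrite !ffunE; case: eqP => //= ->.
Qed.

Lemma gensub_prod (X : A -> Prop) (T : Type) (w : seq T) (f : T -> A) :
  (forall i, gensub X (f i)) -> gensub X (\prod_(i <- w) f i).
Proof. by move=> Xf; apply: big_ind => //; [apply: gensub1|apply: gensubM]. Qed.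

Lemma gensub0 (X : A -> Prop) : gensub X 0.
Proof. exact/asboolP/(rpred0 (gensub_pred X)). Qed.

Lemma gensub_laurent a : gensub (torus_gens x xi) (mon a).
Proof.
apply: gensub_prod => j.
have gx : gensub (torus_gens x xi) (x j) by apply: gensub_in; exists j; left.
have gxi : gensub (torus_gens x xi) (xi j) by apply: gensub_in; exists j; right.
have gX (u : A) k : gensub (torus_gens x xi) u -> gensub (torus_gens x xi) (u ^+ k).
  move=> gu; elim: k => [|k IH]; first exact: gensub1.
  by rewrite exprS; apply: gensubM.
by case: (a j) => k; apply: gX.
Qed.

Lemma lspanM (X : A -> Prop) u v : (forall a b, X a -> X b -> X (a * b)) ->
  lspan X u -> lspan X v -> lspan X (u * v).
Proof.
move=> XM Xu Xv; elim: Xu => [|k a b Xa _ IH]; first by rewrite mul0r; apply: lspan0.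
rewrite mulrDl -scalerAl; apply: lspan_lin => // {b IH}.
elim: Xv => [|k' b c Xb _ IH]; first by rewrite mulr0; apply: lspan0.
by rewrite mulrDr -scalerAr; apply: lspanS => //; apply: XM.
Qed.

Lemma lspan_gensub (X Y : A -> Prop) u : (forall a, X a -> gensub Y a) ->
  lspan X u -> gensub Y u.
Proof.
move=> XY; elim=> [|k a b Xa _ IH]; first exact: gensub0.
by apply: gensub_lin IH; apply: XY.
Qed.

Lemma gensub_lspan (X Y : A -> Prop) u : (forall a, X a -> Y a) -> Y 1 ->
    (forall a b, Y a -> Y b -> Y (a * b)) ->
  gensub X u -> lspan Y u.
Proof.
move=> XY Y1 YM; elim=> [a /XY| |k a b _ IHa _ IHb|a b _ IHa _ IHb].
- exact: lspan_gen.
- exact: lspan_gen.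
- exact: lspan_lin.
exact: lspanM.
Qed.

Lemma gensub_torusP u :
  gensub (torus_gens x xi) u <-> lspan (fun v => exists a, v = mon a) u.
Proof.
split; last by apply: lspan_gensub => _ [a ->]; apply: gensub_laurent.
apply: gensub_lspan.
- move=> _ [j [->|->]]; first by exists (unit_exponent j); rewrite laurent_unit.
  by exists (- unit_exponent j); rewrite laurentN_unit.
- by exists 0; rewrite laurent0.
by move=> _ _ [a ->] [b ->]; exists (a + b); rewrite laurentD.
Qed.

Lemma gensub_familyP (I : Type) (f : I -> A) u :
  gensub (Defs.family f) u <-> lspan (fun v => exists w, v = \prod_(i <- w) f i) u.
Proof.
split.
  apply: gensub_lspan => [_ [i ->]||_ _ [v ->] [w ->]].
  - by exists [:: i]; rewrite big_seq1.
  - by exists [::]; rewrite big_nil.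
  by exists (v ++ w); rewrite big_cat.
apply: lspan_gensub => _ [w ->]; apply: gensub_prod => i.
by apply: gensub_in; exists i.
Qed.

Lemma subalg_ind (X S : A -> Prop) (P : subalg X -> Prop) : P 0 ->
    (forall k a b, P a -> P b -> P (k *: a + b)) ->
    (forall u, gensub X u <-> lspan S u) -> (forall a : subalg X, S (val a) -> P a) ->
  forall a, P a.
Proof.
move=> P0 Plin XS PS a; have /asboolP/XS := valP a.
have [u def_u] : exists u, u = val a by exists (val a).
rewrite -def_u => Su; elim: Su a def_u => [|k v w Sv Sw IH] a def_u.
  by rewrite (_ : a = 0) //; apply: val_inj.
have Xv : v \in gensub_pred X by apply/asboolP/XS/lspan_gen.
have Xw : w \in gensub_pred X by apply/asboolP/XS.
rewrite (_ : a = k *: Subalg Xv + Subalg Xw); last exact: val_inj.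
by apply: Plin; [apply: PS | apply: IH].
Qed.

End Laurent.

(** * The quantum group acts on functionals *)

Section QuantumGroupAction.
Variables (K : fieldType) (r s : K) (ty : lie_type) (n : nat).
Hypotheses (n_adm : admissible ty n) (r0 : r != 0) (s0 : s != 0).
Local Notation I := 'I_(lie_rank ty n).
Local Notation p i j := (struct_const ty n r s (num i) (num j)).
Local Notation serre := (@serre K r s ty n).
Local Notation FA := (falg K (qgen I)).
Local Notation urel := (@urel K r s ty n).

Variables (G : zmodType) (chi : I -> G -> K) (om om' : I -> G).
Hypothesis chi0 : forall i, chi i 0 = 1.
Hypothesis chiD : forall i g h, chi i (g + h) = chi i g * chi i h.
Hypothesis chi_om : forall i j, chi i (om j) = p i j.
Hypothesis chi_om' : forall i j, chi i (om' j) = (p j i)^-1.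

Definition ef_const (i : I) : K := (ri ty n r (num i) - si ty n s (num i))^-1.

Variable T : lmodType K.
Local Notation Fn := (G -> seq I -> seq I -> T).
Local Notation qop := (@qop K I G chi om om' ef_const T).
Local Notation kills := (@kills K I G T serre).

Lemma serre_skewder q i (V : lmodType K) (psi : seq I -> V) : serre q ->
  nceval q (fun w => skewder i (chi^~ (om i)) psi (rev w)) = 0 /\
  nceval q (fun w => skewder i (chi^~ (om' i)) psi (rev w)) = 0.
Proof.
move=> /(serre_skew_null n_adm r0 s0)/(_ i V psi)[kill kill'].
have -> : chi^~ (om i) = (fun k => p k i) by apply/funext.
by have -> : chi^~ (om' i) = (fun k => (p i k)^-1) by apply/funext.
Qed.

Lemma kills_act phi a : kills phi -> kills (act qop phi a).
Proof.
apply: act_ind; first exact: kills0.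
  exact: kills_lin.
by move=> x psi; apply: kills_qop; [exact: serre_homogeneous | exact: serre_skewder].
Qed.

Lemma act_words (x : I -> qgen I) (f : I -> Fn -> Fn) phi w :
  (forall i psi, qop (x i) psi = f i psi) ->
  act qop phi (\prod_(k <- w) fgen K (x k)) = foldl (fun psi i => f i psi) phi w.
Proof.
move=> xf; have -> : \prod_(k <- w) fgen K (x k) = gword K (map x w).
  by rewrite /gword big_map.
rewrite act_gword /act_word; elim: w phi => //= i w IH phi.
by rewrite xf IH.
Qed.

Lemma act_sum phi (q : ncpoly K ty n) (x : seq I -> FA) :
  act qop phi (\sum_(t <- q) t.1 *: x t.2) = nceval q (fun w => act qop phi (x w)).
Proof. exact/esym/(nceval_comp q x (act_linear _ phi)). Qed.

Lemma actB phi a b : act qop phi (a - b) = act qop phi a - act qop phi b.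
Proof. exact: linearB. Qed.

Lemma actZ phi k a : act qop phi (k *: a) = k *: act qop phi a.
Proof. exact: linearZ. Qed.

(** The action descends to the quantum group, on the functionals that respect
    the Serre relations. *)
Lemma act_urel phi a : urel a -> kills phi -> act qop phi a = 0.
Proof.
move=> rel kphi; case: rel => {a} [x y tx ty'|i|i|i j|i j|i j|i j|i j|q Sq|q Sq].
- rewrite actB !actM !act_gen !qop_toral // !translateD.
  by rewrite [shift_of _ _ x + _]addrC subrr.
- by rewrite actB act1 actM !act_gen [X in X - _]translateD addNr translate0 subrr.
- by rewrite actB act1 actM !act_gen [X in X - _]translateD addNr translate0 subrr.
- rewrite actB actZ !actM !act_gen [X in X - _](eop_conj _ _ _ chi0 chiD).
  by rewrite chi_om subrr.
- rewrite actB actZ !actM !act_gen [X in X - _](fop_conj chi0 chiD).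
  by rewrite chi_om subrr.
- rewrite actB actZ !actM !act_gen [X in X - _](eop_conj _ _ _ chi0 chiD).
  by rewrite chi_om' subrr.
- rewrite actB actZ !actM !act_gen [X in X - _](fop_conj chi0 chiD).
  by rewrite chi_om' invrK subrr.
- rewrite 2!actB actZ actB !actM !act_gen [X in X - _ - _](fop_eop _ _ _ chi0 chiD).
  by rewrite [X in X - _]addrAC subrr add0r subrr.
- rewrite (act_sum phi q (fun w => \prod_(k <- w) fgen K (Qe k))).
  under eq_fun do rewrite (act_words (f := @eop K I G chi om om' ef_const T)) //.
  apply: (e_relation _ chi0 chiD _ _ Sq kphi); first exact: serre_homogeneous.
  exact: serre_skewder.
rewrite (act_sum phi q (fun w => \prod_(k <- rev w) fgen K (Qf k))).
under eq_fun do rewrite (act_words (f := @fop K I G chi T)) //.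
by apply: (f_relation _ _ Sq kphi); apply: serre_homogeneous.
Qed.

End QuantumGroupAction.

(** * Triangular decomposition from the action *)

Lemma ffun_int_ind (J : finType) (P : {ffun J -> int} -> Prop) : P 0 ->
    (forall g h, P g -> P h -> P (g + h)) ->
    (forall j, P (unit_exponent j)) -> (forall j, P (- unit_exponent j)) ->
  forall g, P g.
Proof.
move=> P0 PD P1 PN g.
have -> : g = \sum_j unit_exponent j *~ g j.
  apply/ffunP => i; rewrite sum_ffunE (bigD1 i) //= big1 ?addr0.
    by rewrite ffunMzE ffunE eqxx intz.
  by move=> j /negPf neq_ji; rewrite ffunMzE ffunE eq_sym neq_ji mul0rz.
have Pn h k : P h -> P (h *+ k).
  by move=> Ph; elim: k => // k IH; rewrite mulrS; apply: PD.
apply: big_ind => // j _; case: (g j) => k; first exact/Pn/P1.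
by rewrite -[_ *~ _]/(- (unit_exponent j *+ k.+1)) -mulNrn; apply/Pn/PN.
Qed.

(* A is U_{r,s}(g) or its one-parameter quotient, pi the projection from the
   free algebra and sec a section of it.  The generators x j and their inverses
   xi j give coordinates on the torus of A, and by pi_ker the action on
   functionals is one of A. *)
Section Criterion.
Variables (K : fieldType) (r s : K) (ty : lie_type) (n : nat).
Hypotheses (n_adm : admissible ty n) (r0 : r != 0) (s0 : s != 0).
Local Notation I := 'I_(lie_rank ty n).
Local Notation p i j := (struct_const ty n r s (num i) (num j)).
Local Notation serre := (@serre K r s ty n).
Local Notation FA := (falg K (qgen I)).
Local Notation urel := (@urel K r s ty n).

Variable J : finType.
Local Notation G := {ffun J -> int}.
Variables (chi : I -> G -> K) (om om' : I -> G).
Hypothesis chi0 : forall i, chi i 0 = 1.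
Hypothesis chiD : forall i g h, chi i (g + h) = chi i g * chi i h.
Hypothesis chi_om : forall i j, chi i (om j) = p i j.
Hypothesis chi_om' : forall i j, chi i (om' j) = (p j i)^-1.

Local Notation c := (@ef_const K r s ty n).
Local Notation qop T := (@qop K I G chi om om' c T).
Local Notation kills := (kills serre).
Local Notation shift_of := (@shift_of I G om om').

Variables (A : algType K) (pi : FA -> A) (sec : A -> FA).
Hypothesis pi_linear : linear pi.
Hypothesis pi_mul : monoid_morphism pi.
Hypothesis secK : cancel sec pi.
Hypothesis pi_urel : forall a, urel a -> pi a = 0.
Hypothesis pi_ker : forall (T : lmodType K) (phi : G -> seq I -> seq I -> T) a,
  kills phi -> pi a = 0 -> act (qop T) phi a = 0.

Definition gen (y : qgen I) : A := pi (fgen K y).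

Variables (x xi : J -> qgen I).
Local Notation X := (fun j => gen (x j)).
Local Notation XI := (fun j => gen (xi j)).
Local Notation mon := (laurent_monomial X XI).
Hypothesis x_toral : forall j, toral (x j) && toral (xi j).
Hypothesis x_inv : forall j, gen (x j) * gen (xi j) = 1 /\ gen (xi j) * gen (x j) = 1.
Hypothesis x_shift : forall j,
  shift_of (x j) = unit_exponent j /\ shift_of (xi j) = - unit_exponent j.
Hypothesis gen_toral : forall y, toral y -> gen y = mon (shift_of y).

Let piB a b : pi (a - b) = pi a - pi b.
Proof. by rewrite -scaleN1r addrC pi_linear scaleN1r addrC. Qed.

Let piM a b : pi (a * b) = pi a * pi b. Proof. exact: pi_mul.2. Qed.

Let pi1 : pi 1 = 1. Proof. exact: pi_mul.1. Qed.

Let piZ k a : pi (k *: a) = k *: pi a. Proof. exact: linear_mapZ. Qed.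

Let pi_eq a b : urel (a - b) -> pi a = pi b.
Proof. by move/pi_urel/eqP; rewrite piB subr_eq0 => /eqP. Qed.

Lemma gen_comm y z : toral y -> toral z -> gen y * gen z = gen z * gen y.
Proof. by move=> ty' tz; rewrite -!piM; apply/pi_eq/urel_comm. Qed.

Let x_comm i j : gen (x i) * gen (x j) = gen (x j) * gen (x i).
Proof. by apply: gen_comm; [case/andP: (x_toral i) | case/andP: (x_toral j)]. Qed.

Let monD g h : mon (g + h) = mon g * mon h. Proof. exact: laurentD. Qed.

Let mon0 : mon 0 = 1. Proof. exact: laurent0. Qed.

(** A relation omega e omega^-1 = k(omega) e for the omega_j and omega'_j
    determines how e commutes with the inverses too. *)
Lemma gen_weight (e : A) (k : G -> K) : k 0 = 1 ->
    (forall g h, k (g + h) = k g * k h) ->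
    (forall j, gen (Qw j) * e * gen (Qwi j) = k (om j) *: e) ->
    (forall j, gen (Qw' j) * e * gen (Qwi' j) = k (om' j) *: e) ->
  forall y, toral y -> gen y * e = k (shift_of y) *: (e * gen y).
Proof.
move=> k0 kD kw kw'.
have weight y z h : toral y -> toral z -> gen y * gen z = 1 ->
    gen y * e * gen z = k h *: e ->
  gen y * e = k h *: (e * gen y) /\ gen z * e = k (- h) *: (e * gen z).
  move=> ty' tz yz yez; have zy : gen z * gen y = 1 by rewrite gen_comm.
  have ye : gen y * e = k h *: (e * gen y).
    by rewrite -[LHS]mulr1 -zy mulrA yez -scalerAl.
  split=> //; have kN : k (- h) * k h = 1 by rewrite -kD addNr.
  have ey : e * gen y = k (- h) *: (gen y * e) by rewrite ye scalerA kN scale1r.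
  rewrite -[LHS]mulr1 -yz -mulrA (mulrA e) ey -scalerAl -scalerAr !mulrA zy.
  by rewrite mul1r.
have ww j : gen (Qw j) * gen (Qwi j) = 1.
  by rewrite -piM -pi1; apply/pi_eq/urel_w.
have ww' j : gen (Qw' j) * gen (Qwi' j) = 1.
  by rewrite -piM -pi1; apply/pi_eq/urel_w'.
by case=> // j _; [case: (weight _ _ _ _ _ (ww j) (kw j))
  | case: (weight _ _ _ _ _ (ww j) (kw j))
  | case: (weight _ _ _ _ _ (ww' j) (kw' j))
  | case: (weight _ _ _ _ _ (ww' j) (kw' j))].
Qed.

Lemma mon_weight (e : A) (k : G -> K) : k 0 = 1 ->
    (forall g h, k (g + h) = k g * k h) ->
    (forall j, gen (Qw j) * e * gen (Qwi j) = k (om j) *: e) ->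
    (forall j, gen (Qw' j) * e * gen (Qwi' j) = k (om' j) *: e) ->
  forall g, mon g * e = k g *: (e * mon g).
Proof.
move=> k0 kD kw kw'; have gen_e := gen_weight k0 kD kw kw'.
apply: ffun_int_ind => [|g h IHg IHh|j|j].
- by rewrite mon0 k0 scale1r mul1r mulr1.
- rewrite monD -mulrA IHh -scalerAr (mulrA (mon g) e) IHg -scalerAl scalerA.
  by rewrite kD mulrC -mulrA.
- have [/andP[tx _] [<- _]] := (x_toral j, x_shift j).
  by rewrite -gen_toral // gen_e.
have [/andP[_ tx] [_ <-]] := (x_toral j, x_shift j).
by rewrite -gen_toral // gen_e.
Qed.

Lemma mon_e g i : mon g * gen (Qe i) = chi i g *: (gen (Qe i) * mon g).
Proof.
move: g; apply: mon_weight => // j; rewrite -!piM.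
  by rewrite chi_om -piZ; apply/pi_eq/urel_we.
by rewrite chi_om' -piZ; apply/pi_eq/urel_w'e.
Qed.

Lemma mon_f g i : mon g * gen (Qf i) = (chi i g)^-1 *: (gen (Qf i) * mon g).
Proof.
move: g; apply: (mon_weight (k := fun g => (chi i g)^-1)) => [|g h|j|j].
- by rewrite chi0 invr1.
- by rewrite chiD invfM.
- by rewrite -!piM chi_om -piZ; apply/pi_eq/urel_wf.
by rewrite -!piM chi_om' invrK -piZ; apply/pi_eq/urel_w'f.
Qed.

(** The lift to A of the action of the free algebra on functionals. *)
Definition lift_act (T : lmodType K) (phi : G -> seq I -> seq I -> T) (a : A) :=
  act (qop T) phi (sec a).

Section LiftAct.
Variable T : lmodType K.
Implicit Type phi : G -> seq I -> seq I -> T.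

Lemma lift_act_pi phi a : kills phi -> lift_act phi (pi a) = act (qop T) phi a.
Proof.
move=> kphi; apply/eqP; rewrite -subr_eq0 -linearB; apply/eqP/pi_ker => //.
by rewrite piB secK subrr.
Qed.

Lemma lift_act_linear phi : kills phi -> linear (lift_act phi).
Proof.
move=> kphi k a b; rewrite -{1}[a]secK -{1}[b]secK -pi_linear lift_act_pi //.
exact: act_linear.
Qed.

Lemma lift_actM phi a b : kills phi ->
  lift_act phi (a * b) = lift_act (lift_act phi a) b.
Proof.
move=> kphi; have -> : a * b = pi (sec a * sec b) by rewrite piM !secK.
rewrite (lift_act_pi (sec a * sec b) kphi); exact: (actM (qop T) phi).
Qed.

Lemma lift_act1 phi : kills phi -> lift_act phi 1 = phi.
Proof. by move=> kphi; rewrite -pi1 lift_act_pi // act1. Qed.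

Lemma lift_act_gen phi y : kills phi -> lift_act phi (gen y) = qop T y phi.
Proof. by move=> kphi; rewrite lift_act_pi // act_gen. Qed.

Lemma kills_lift_act phi a : kills phi -> kills (lift_act phi a).
Proof. exact: kills_act. Qed.

Lemma lift_act_mon phi g : kills phi -> lift_act phi (mon g) = translate g phi.
Proof.
move: g phi; apply: ffun_int_ind => [|g h IHg IHh|j|j] phi kphi.
- by rewrite mon0 lift_act1 // translate0.
- have kphi_g := kills_lift_act (mon g) kphi.
  rewrite monD lift_actM // IHh // IHg //.
  by rewrite translateD addrC.
- rewrite laurent_unit // lift_act_gen // qop_toral; last by case/andP: (x_toral j).
  by have [-> _] := x_shift j.
rewrite laurentN_unit // lift_act_gen // qop_toral; last by case/andP: (x_toral j).
by have [_ ->] := x_shift j.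
Qed.

Lemma lift_act_ewords phi w : kills phi ->
  lift_act phi (\prod_(i <- w) gen (Qe i)) = eword chi om om' c w phi.
Proof.
elim: w phi => [|i w IH] phi kphi; first by rewrite big_nil lift_act1.
rewrite big_cons lift_actM // IH; last exact: kills_lift_act.
by rewrite lift_act_gen.
Qed.

Lemma lift_act_fwords phi w : kills phi ->
  lift_act phi (\prod_(i <- w) gen (Qf i)) = fword chi w phi.
Proof.
elim: w phi => [|i w IH] phi kphi; first by rewrite big_nil lift_act1.
rewrite big_cons lift_actM // IH; last exact: kills_lift_act.
by rewrite lift_act_gen.
Qed.

(** The functional phi is recovered, up to the nonzero scalars chi, from the
    values at the origin of its translates by ordered monomials. *)
Lemma lift_act_triangular phi u g v : kills phi ->
  lift_act phi (\prod_(i <- u) gen (Qf i) * mon g * \prod_(i <- v) gen (Qe i))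
    0 [::] [::] = (\prod_(i <- u) chi i g) *: phi g u v.
Proof.
move=> kphi; rewrite !lift_actM //.
have kphi_u := kills_lift_act (\prod_(i <- u) gen (Qf i)) kphi.
rewrite lift_act_ewords; last exact: kills_lift_act.
rewrite ewordE cats0 lift_act_mon // lift_act_fwords // /translate add0r fwordE.
by rewrite cats0 big1 ?scale1r // => i _; rewrite chi0 invr1.
Qed.

End LiftAct.

Lemma gen_ef i j : gen (Qe i) * gen (Qf j) = gen (Qf j) * gen (Qe i)
  + ((i == j)%:R * c i) *: (mon (om i) - mon (om' i)).
Proof.
rewrite -[om i]/(shift_of (Qw i)) -[om' i]/(shift_of (Qw' i)) -!gen_toral //.
apply/eqP; rewrite addrC -subr_eq -!piM -!piB -piZ; apply/eqP/pi_eq.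
exact: urel_ef.
Qed.

Lemma e_serre q : serre q -> nceval q (fun w => \prod_(k <- w) gen (Qe k)) = 0.
Proof.
move=> /(urel_serre_e (r := r)) /pi_urel; rewrite -[X in pi X]/(nceval q
  (fun w => \prod_(k <- w) fgen K (Qe k))) -(nceval_comp _ _ pi_linear) => rel.
by rewrite -[RHS]rel; congr nceval; apply/funext => w; rewrite (big_morph _ piM pi1).
Qed.

Lemma f_serre q : serre q -> nceval q (fun w => \prod_(k <- rev w) gen (Qf k)) = 0.
Proof.
move=> /(urel_serre_f (r := r)) /pi_urel; rewrite -[X in pi X]/(nceval q
  (fun w => \prod_(k <- rev w) fgen K (Qf k))) -(nceval_comp _ _ pi_linear) => rel.
by rewrite -[RHS]rel; congr nceval; apply/funext => w; rewrite (big_morph _ piM pi1).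
Qed.

Definition ordered_monomial (a : A) : Prop := exists u g v,
  a = \prod_(i <- u) gen (Qf i) * mon g * \prod_(i <- v) gen (Qe i).

Lemma lspan_stable (S : A -> Prop) (b : A) : (forall a, S a -> lspan S (b * a)) ->
  forall a, lspan S a -> lspan S (b * a).
Proof.
move=> bS a; elim=> [|k u v Su _ IH]; first by rewrite mulr0; apply: lspan0.
by rewrite mulrDr -scalerAr; apply: lspan_lin IH; apply: bS.
Qed.

Lemma lspanZ (S : A -> Prop) k a : lspan S a -> lspan S (k *: a).
Proof. by move=> Sa; rewrite -[_ *: _]addr0; apply/lspan_lin/lspan0. Qed.

(** The span of the ordered monomials is a left ideal: f_i lengthens the word
    u, torus elements move across f_u, and e_i moves across f_u leaving torus
    elements behind, which have been dealt with. *)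
Lemma ordered_f i a : lspan ordered_monomial a -> lspan ordered_monomial (gen (Qf i) * a).
Proof.
apply: lspan_stable => _ [u [g [v ->]]]; apply: lspan_gen; exists (i :: u), g, v.
by rewrite big_cons !mulrA.
Qed.

Lemma ordered_mon h a : lspan ordered_monomial a -> lspan ordered_monomial (mon h * a).
Proof.
apply: lspan_stable => _ [u [g [v ->]]]; elim: u => [|i u IH].
  rewrite big_nil mul1r mulrA -monD; apply: lspan_gen; exists [::], (h + g), v.
  by rewrite big_nil mul1r.
rewrite big_cons -!mulrA mulrA mon_f -scalerAl -mulrA; apply/lspanZ/ordered_f.
by rewrite [_ * (mon g * _)]mulrA.
Qed.

Lemma ordered_e i a : lspan ordered_monomial a -> lspan ordered_monomial (gen (Qe i) * a).
Proof.
apply: lspan_stable => _ [u [g [v ->]]]; elim: u => [|j u IH].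
  have -> : gen (Qe i) * (\prod_(k <- [::]) gen (Qf k) * mon g * \prod_(k <- v) gen (Qe k))
    = (chi i g)^-1 *: (1 * mon g * \prod_(k <- i :: v) gen (Qe k)).
    have em : gen (Qe i) * mon g = (chi i g)^-1 *: (mon g * gen (Qe i)).
      by rewrite mon_e scalerA mulVf ?scale1r // (chi_neq0 chi0 chiD).
    by rewrite big_nil big_cons !mul1r mulrA em -scalerAl -mulrA.
  apply/lspanZ/lspan_gen; exists [::], g, (i :: v).
  by rewrite big_nil.
rewrite big_cons -!mulrA [\prod_(k <- u) _ * _]mulrA.
have Su : lspan ordered_monomial
    (\prod_(k <- u) gen (Qf k) * mon g * \prod_(k <- v) gen (Qe k)).
  by apply: lspan_gen; exists u, g, v.
rewrite (mulrA (gen (Qe i))) gen_ef mulrDl -[X in X + _]mulrA addrC -scalerAl mulrBl.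
apply: lspan_lin; last exact: ordered_f.
by rewrite addrC -scaleN1r; apply: lspan_lin; apply: ordered_mon.
Qed.

Lemma ordered_span a : lspan ordered_monomial a.
Proof.
rewrite -[a]secK; elim/falg_ind: (sec a) => [|k w b IH].
  by rewrite (linear_map0 pi_linear); apply: lspan0.
rewrite pi_linear; apply: lspan_lin IH => {b}; elim: w => [|y w IH].
  rewrite /gword big_nil pi1; apply: lspan_gen; exists [::], 0, [::].
  by rewrite !big_nil mon0 !mulr1.
have -> : pi (gword K (y :: w)) = gen y * pi (gword K w).
  by rewrite /gword big_cons piM.
have [ty'|] := boolP (toral y); first by rewrite gen_toral //; apply: ordered_mon.
by case: y => // i _; [apply: ordered_e | apply: ordered_f].
Qed.

(** The indicator function of b respects the Serre relations, none of which
    has a constant term, and it reads off the coefficient of the monomial b. *)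
Theorem laurent_torus : laurent_polynomials X XI.
Proof.
split=> //; first exact: gensub_torusP.
move=> w k uniq_w sum0 b wb.
pose phi : G -> seq I -> seq I -> K^o :=
  fun g u v => ((g == b) && nilp u && nilp v)%:R.
have kphi : kills phi.
  move=> q Sq; have /allP q_nil := serre_words Sq.
  split=> [g a d v|g u a d]; rewrite /nceval big_seq big1 // => t /q_nil t_nil.
    rewrite /phi (_ : nilp (a ++ _) = false) ?andbF ?andFb ?scaler0 //.
    by apply: contraNF t_nil; rewrite /nilp !size_cat size_rev !addn_eq0 => /and3P[].
  rewrite /phi (_ : nilp (a ++ _) = false) ?andbF ?scaler0 //.
  by apply: contraNF t_nil; rewrite /nilp !size_cat !addn_eq0 => /and3P[].
have lin : linear (fun a => lift_act phi a 0 [::] [::]).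
  by move=> d u v; rewrite lift_act_linear.
have := congr1 (fun a => lift_act phi a 0 [::] [::]) sum0.
rewrite [LHS]/= (linear_map0 lin) => <-.
have lin_sum (t : seq G) : lift_act phi (\sum_(a <- t) k a *: mon a) 0 [::] [::] =
    \sum_(a <- t) k a * (a == b)%:R.
  elim: t => [|a t IH]; first by rewrite !big_nil (linear_map0 lin).
  rewrite !big_cons lift_act_linear // -IH lift_act_mon //.
  by congr (_ * _ + _); rewrite /translate add0r /phi !andbT.
rewrite lin_sum (bigD1_seq b) //= eqxx mulr1 big1 ?addr0 // => a /negPf ->.
by rewrite mulr0.
Qed.

(** * The multiplication map *)

Local Notation subN := (subalg (Defs.family (fun i => gen (Qf i)))).
Local Notation subZ := (subalg (torus_gens X XI)).
Local Notation subP := (subalg (Defs.family (fun i => gen (Qe i)))).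
Local Notation T := (tens (tens subN subZ) subP).

Let val_linear (Y : A -> Prop) : linear (val : subalg Y -> A).
Proof. by move=> k u v; rewrite linearP. Qed.

Let mult2 (u : subN) (z : subZ) : A := val u * val z.

Let mult2_bilin : bilin mult2.
Proof.
split=> [z k u v|u k z w]; rewrite /mult2 linearP.
  by rewrite mulrDl -scalerAl.
by rewrite mulrDr -scalerAr.
Qed.

Let mult3 (t : tens subN subZ) (v : subP) : A := tens_lift mult2 t * val v.

Let mult3_bilin : bilin mult3.
Proof.
split=> [v k t t'|t k v v']; rewrite /mult3.
  by rewrite (tens_lift_linear mult2_bilin) mulrDl -scalerAl.
by rewrite linearP mulrDr -scalerAr.
Qed.

Definition mult_map : T -> A := tens_lift mult3.

Lemma mult_map_linear : linear mult_map.
Proof. exact: tens_lift_linear mult3_bilin. Qed.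

Lemma mult_mapE u z v : mult_map (tensor (tensor u z) v) = val u * val z * val v.
Proof.
by rewrite /mult_map (tens_liftE mult3_bilin) /mult3 (tens_liftE mult2_bilin).
Qed.

HB.instance Definition _ := GRing.isLinear.Build K T A _ mult_map mult_map_linear.

Lemma fword_gensub w : \prod_(i <- w) gen (Qf i) \in
  gensub_pred (Defs.family (fun i => gen (Qf i))).
Proof. by apply/asboolP/gensub_prod => i; apply: gensub_in; exists i. Qed.

Lemma eword_gensub w : \prod_(i <- w) gen (Qe i) \in
  gensub_pred (Defs.family (fun i => gen (Qe i))).
Proof. by apply/asboolP/gensub_prod => i; apply: gensub_in; exists i. Qed.

Lemma mon_gensub g : mon g \in gensub_pred (torus_gens X XI).
Proof. exact/asboolP/gensub_laurent. Qed.

(** The scalar compensates the one in lift_act_triangular. *)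
Definition tensor_functional : G -> seq I -> seq I -> T := fun g u v =>
  (\prod_(i <- u) chi i g)^-1 *:
    tensor (tensor (Subalg (fword_gensub u)) (Subalg (mon_gensub g)))
           (Subalg (eword_gensub v)).

Lemma word_ideal (y : I -> A) (f : seq I -> seq I) q a b :
    nceval q (fun w => \prod_(k <- f w) y k) = 0 ->
  nceval q (fun w => \prod_(k <- a ++ f w ++ b) y k) = 0.
Proof.
move=> rel; pose F d := \prod_(k <- a) y k * d * \prod_(k <- b) y k.
have linF : linear F.
  by move=> k d d'; rewrite /F mulrDr mulrDl -scalerAr -scalerAl.
rewrite -[RHS](linear_map0 linF) -rel -(nceval_comp _ _ linF).
by congr nceval; apply/funext => w; rewrite /F !big_cat /= mulrA.
Qed.

Lemma kills_tensor_functional : kills tensor_functional.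
Proof.
move=> q Sq; split=> [g a b v|g u a b].
  apply: (nceval_weight (wt := fun w => (\prod_(i <- a ++ rev w ++ b) chi i g)^-1)).
  - exact: serre_homogeneous Sq.
  - move=> w w' eq_w; congr (_^-1); apply: perm_big.
    by rewrite perm_cat2l perm_cat2r perm_rev perm_sym perm_rev perm_sym.
  set z := Subalg (mon_gensub g); set y := Subalg (eword_gensub v).
  have lin : linear (fun u : subN => tensor (tensor u z) y).
    by move=> k u u' /=; rewrite tensorDl tensorZl tensorDl tensorZl.
  rewrite (nceval_comp q (fun w => Subalg (fword_gensub (a ++ rev w ++ b))) lin).
  rewrite (_ : nceval _ _ = 0) ?(linear_map0 lin) //; apply: val_inj.
  rewrite -(nceval_comp q (fun w => Subalg (fword_gensub (a ++ rev w ++ b)))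
    (@val_linear _)) /=.
  exact/word_ideal/f_serre.
set t := tensor (Subalg (fword_gensub u)) (Subalg (mon_gensub g)).
have lin : linear (fun y : subP => tensor t y).
  by move=> k d d'; rewrite tensorDr tensorZr.
rewrite ncevalZ (nceval_comp q (fun w => Subalg (eword_gensub (a ++ w ++ b))) lin).
rewrite (_ : nceval _ _ = 0) ?(linear_map0 lin) ?scaler0 //; apply: val_inj.
rewrite -(nceval_comp q (fun w => Subalg (eword_gensub (a ++ w ++ b)))
  (@val_linear _)) /=.
exact: (word_ideal (f := id) _ _ (e_serre Sq)).
Qed.

(** The inverse of the multiplication map. *)
Definition split_map (a : A) : T := lift_act tensor_functional a 0 [::] [::].

Lemma split_map_linear : linear split_map.
Proof.
by move=> k a b; rewrite /split_map lift_act_linear //; apply: kills_tensor_functional.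
Qed.

Lemma split_mapE u g v :
  split_map (\prod_(i <- u) gen (Qf i) * mon g * \prod_(i <- v) gen (Qe i)) =
  tensor (tensor (Subalg (fword_gensub u)) (Subalg (mon_gensub g)))
         (Subalg (eword_gensub v)).
Proof.
rewrite /split_map lift_act_triangular; last exact: kills_tensor_functional.
rewrite /tensor_functional scalerA divff ?scale1r //.
by rewrite prodf_seq_neq0; apply/allP => i _; apply: (chi_neq0 chi0 chiD).
Qed.

Lemma split_mapK : cancel split_map mult_map.
Proof.
move=> a; elim: (ordered_span a) => [|k b d [u [g [v ->]]] _ IH].
  by rewrite (linear_map0 split_map_linear) linear0.
rewrite (split_map_linear k _ d) (mult_map_linear k _ (split_map d)) [X in _ + X]IH.
by congr (_ *: _ + _); rewrite (split_mapE u g v); exact: mult_mapE.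
Qed.

Lemma mult_mapK : cancel mult_map split_map.
Proof.
pose fixed t := split_map (mult_map t) = t.
have fixed_lin k t t' : fixed t -> fixed t' -> fixed (k *: t + t').
  by rewrite /fixed mult_map_linear split_map_linear => -> ->.
have fixed0 : fixed 0.
  by rewrite /fixed (linear_map0 mult_map_linear) (linear_map0 split_map_linear).
have zero_l (V W : lmodType K) (w : W) : tensor (0 : V) w = 0.
  by rewrite -(scale0r 0) tensorZl scale0r.
have zero_r (V W : lmodType K) (v : V) : tensor v (0 : W) = 0.
  by rewrite -(scale0r 0) tensorZr scale0r.
have fixed_tensor (u : subN) (z : subZ) (v : subP) : fixed (tensor (tensor u z) v).
  move: u; apply: (subalg_ind _ _ (gensub_familyP _)); first by rewrite !zero_l.
    by move=> k a b fa fb; rewrite tensorDl tensorZl tensorDl tensorZl; apply: fixed_lin.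
  move=> u [wu def_u]; move: z.
  apply: (subalg_ind _ _ (gensub_torusP x_inv x_comm)); first by rewrite zero_r zero_l.
    by move=> k a b fa fb; rewrite tensorDr tensorZr tensorDl tensorZl; apply: fixed_lin.
  move=> z [g def_z]; move: v.
  apply: (subalg_ind _ _ (gensub_familyP _)); first by rewrite zero_r.
    by move=> k a b fa fb; rewrite tensorDr tensorZr; apply: fixed_lin.
  move=> v [wv def_v].
  have -> : u = Subalg (fword_gensub wu) by apply: val_inj; exact: def_u.
  have -> : z = Subalg (mon_gensub g) by apply: val_inj; exact: def_z.
  have -> : v = Subalg (eword_gensub wv) by apply: val_inj; exact: def_v.
  rewrite /fixed (mult_mapE (Subalg (fword_gensub wu)) (Subalg (mon_gensub g))).
  exact: split_mapE.
elim/tens_ind => [//|k t v t' IH]; apply: (fixed_lin) => // {IH}.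
elim/tens_ind: t => [|l u z t IH]; first by rewrite zero_l.
by rewrite tensorDl tensorZl; apply: fixed_lin.
Qed.

Theorem triangular : triangular_decomposition
  (Defs.family (fun i => gen (Qf i))) (torus_gens X XI)
  (Defs.family (fun i => gen (Qe i))).
Proof.
exists mult_map; split; first exact: mult_mapE.
by exists split_map; [exact: mult_mapK | exact: split_mapK].
Qed.

End Criterion.

(** * The two quantum groups *)

Section TorusCharacter.
Variables (K : fieldType) (J : finType) (wt : J -> K).
Hypothesis wt0 : forall j, wt j != 0.

Definition torus_char (g : {ffun J -> int}) : K := \prod_j wt j ^ g j.

Lemma torus_char0 : torus_char 0 = 1.
Proof. by rewrite /torus_char big1 // => j _; rewrite ffunE expr0z. Qed.

Lemma torus_charD g h : torus_char (g + h) = torus_char g * torus_char h.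
Proof.
by rewrite /torus_char -big_split; apply: eq_bigr => j _; rewrite ffunE expfzDr.
Qed.

Lemma torus_char_unit j : torus_char (unit_exponent j) = wt j.
Proof.
rewrite /torus_char (bigD1 j) //= big1 ?mulr1; first by rewrite ffunE eqxx.
by move=> i /negPf neq_ij; rewrite ffunE neq_ij.
Qed.

End TorusCharacter.

Lemma struct_const_neq0 (K : fieldType) (r s : K) ty n i j :
  r != 0 -> s != 0 -> struct_const ty n r s i j != 0.
Proof.
move=> r0 s0; have rz k : r ^ k != 0 by apply: expfz_neq0.
have sz k : s ^ k != 0 by apply: expfz_neq0.
rewrite /struct_const; case: ty; first exact: mulf_neq0.
- case: ifP => _; first exact: mulf_neq0.
  by case: ifP => _; rewrite ?rz // mulf_neq0 ?invr_eq0.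
- case: ifP => _; first exact: mulf_neq0.
  by case: ifP => _; rewrite ?rz // mulf_neq0 ?invr_eq0 ?expf_neq0.
case: ifP => _; first exact: mulf_neq0.
by case: ifP => _; rewrite mulf_neq0 ?invr_eq0 ?rz ?sz.
Qed.

(** As eps_j - eps_(j+1) = alpha_j, the exponents of r and of s = 1/r combine
    into an inner product of roots, which is symmetric in i and j. *)
Lemma struct_const_one_param (K : fieldType) (q : K) ty n i j :
    admissible ty n -> q != 0 ->
    (if ty is TypeA then i < n else i <= n)%N ->
    (if ty is TypeA then j < n else j <= n)%N -> (0 < i)%N ->
  struct_const ty n q q^-1 i j =
    q ^ ((long_exp ty)%:Z * ip (simple_root ty n i) (simple_root ty n j)).
Proof.
move=> n_adm q0 le_in le_jn i0.
have n1 : (1 < n)%N by move: n_adm; case: ty {le_in le_jn} => /=; lia.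
have [lt_jn|ge_jn] := ltnP j n.
  rewrite /struct_const lt_jn (ipC (simple_root _ _ i)) (ip_root _ _ lt_jn) mulrBr expfzDr //.
  rewrite -mulrN !exprz_inv.
  by case: ty {le_in le_jn n_adm}; rewrite /= ?mul1r // mulrN.
have j_n : j = n by case: ty le_jn {le_in n_adm} => /=; lia.
have tyA : ty <> TypeA by move=> tyA; move: le_jn; rewrite tyA; lia.
have root_n : simple_root ty n n = match ty with
    | TypeA => 0 | TypeB => eps n n | TypeC => eps n n *+ 2
    | TypeD => eps n n.-1 + eps n n end.
  by rewrite /simple_root ltnn.
rewrite j_n /struct_const ltnn {j_n ge_jn le_jn j}.
have [lt_in|ge_in] := ltnP i n.
  rewrite (ipC (simple_root _ _ i)) root_n; case: ty tyA {n_adm root_n le_in} => //= _.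
  - by rewrite mul1r [in RHS]ipC mulr2n ipDr (ipC _ (eps n n)); congr (q ^ _); lia.
  have [->|neq_i] := eqVneq i n.-1.
    rewrite /= mulfV ?invr_eq0 // mul1r ipC ipDr !(ipC _ (eps n _)).
    rewrite [X in q ^ X](_ : _ = 0) ?expr0z // !ip_eps_root //; lia.
  by rewrite /= exprz_inv opprK -expfzDr // mul1r [in RHS]ipC ipDr !(ipC _ (eps n _)).
have -> : i = n by case: ty le_in {n_adm tyA root_n} => /=; lia.
have ip_nn : ip (simple_root ty n n) (simple_root ty n n) =
    match ty with TypeA => 0 | TypeB => 1 | TypeC => 4 | TypeD => 2 end.
  rewrite {1}root_n ipC; case: ty tyA {n_adm root_n le_in} => //= _.
  - by rewrite ipC ip_eps_root_last //; lia.
  - by rewrite mulr2n ipDr !(ipC _ (eps n _)) !ip_eps_root_last //; lia.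
  by rewrite ipDr !(ipC _ (eps n _)) !ip_eps_root_last //; lia.
rewrite ip_nn; case: ty tyA {n_adm root_n le_in ip_nn} => //= _.
- by rewrite invrK -expr2.
- by rewrite mul1r exprVn invrK -exprD.
rewrite (_ : n != n.-1); last by lia.
have [n'0 n0] : (0 < n.-1)%N /\ (0 < n)%N by split; lia.
have [n'n nn'] : (n.-1 == n) = false /\ (n == n.-1) = false by split; lia.
rewrite (ip_eps_root_last _ n1 n'0) (ip_eps_root_last _ n1 n0) !eqxx n'n nn'.
by rewrite exprz_inv opprK.
Qed.

Section Instances.
Variables (K : fieldType) (r s : K) (ty : lie_type) (n : nat).
Hypotheses (n_adm : admissible ty n) (r0 : r != 0) (s0 : s != 0).
Local Notation I := 'I_(lie_rank ty n).
Local Notation p i j := (struct_const ty n r s (num i) (num j)).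
Local Notation serre := (@serre K r s ty n).
Local Notation FA := (falg K (qgen I)).
Local Notation urel := (@urel K r s ty n).
Local Notation Urs := (Urs r s ty n).
Local Notation Urs_quot := (Urs_quot r s ty n).
Local Notation ugen := (@ugen K r s ty n).
Local Notation qgen_quot := (@qgen_quot K r s ty n).
Local Notation torus_rel := (@torus_rel K r s ty n).

Let p0 (i j : I) : p i j != 0. Proof. exact: struct_const_neq0. Qed.

Lemma aproj_urel_eq0 (a : FA) : urel a -> aproj urel a = 0.
Proof.
move=> rel; rewrite -(linear0 (aproj urel)); apply/aproj_eq.
by rewrite subr0; apply: ideal_gen_sub.
Qed.

Lemma aproj_urel_ker (a : FA) : aproj urel a = 0 -> ideal_gen urel a.
Proof. by move=> a0; rewrite -[a]subr0; apply/aproj_eq; rewrite linear0. Qed.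

Section Ideal.
Variables (G : zmodType) (chi : I -> G -> K) (om om' : I -> G).
Hypothesis chi0 : forall i, chi i 0 = 1.
Hypothesis chiD : forall i g h, chi i (g + h) = chi i g * chi i h.
Hypothesis chi_om : forall i j, chi i (om j) = p i j.
Hypothesis chi_om' : forall i j, chi i (om' j) = (p j i)^-1.
Local Notation qop T := (@qop K I G chi om om' (@ef_const K r s ty n) T).

Lemma act_urel_ideal (T : lmodType K) (phi : G -> seq I -> seq I -> T) a :
  kills serre phi -> aproj urel a = 0 -> act (qop T) phi a = 0.
Proof.
move=> kphi /aproj_urel_ker Ia; apply: (act_ideal (P := kills serre)) Ia kphi.
  by move=> psi b; apply: kills_act.
by move=> psi b rel kpsi; apply: act_urel.
Qed.

(** When om' i = - om i in the lattice, omega'_i and omega_i^-1 act by the same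
    translation. *)
Lemma act_torus_ideal (T : lmodType K) (phi : G -> seq I -> seq I -> T) a :
    (forall i, om' i = - om i) -> kills serre phi ->
  ideal_gen torus_rel (aproj urel a) -> act (qop T) phi a = 0.
Proof.
move=> om'N kphi Ia; have [u def_u] : exists u, u = aproj urel a by exists (aproj urel a).
move: Ia; rewrite -def_u => Iu; elim: Iu a def_u => [|k y z [b [w [d [[i ->] ->]]]] _ IH] a.
  by move/esym; apply: act_urel_ideal.
have [[b' ->] [d' ->]] := (aproj_surj b, aproj_surj d).
have [z' def_z] := aproj_surj z; rewrite def_z => def_a.
pose t := fgen K (Qw' i) - fgen K (Qwi i).
have act_z : act (qop T) phi z' = 0 by apply: IH.
have : act (qop T) phi (a - (k *: (b' * t * d') + z')) = 0.
  apply: act_urel_ideal => //; rewrite linearB /= -def_a.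
  have tE : aproj urel t = ugen (Qw' i) - ugen (Qwi i) by rewrite /t linearB.
  rewrite -tE -(rmorphM (aproj urel)) -(rmorphM (aproj urel)).
  by rewrite -linearP subrr.
rewrite actB linearP /= act_z addr0 !actM.
have act_t psi : act (qop T) psi t = 0.
  have omE : qop T (Qw' i) psi = qop T (Qwi i) psi.
    exact: (congr1 (fun h => translate h psi) (om'N i)).
  rewrite /t actB 2!act_gen; apply/eqP; rewrite subr_eq0; apply/eqP.
  exact: omE.
have act_btd : act (qop T) (act (qop T) (act (qop T) phi b') t) d' = 0.
  exact: (etrans (congr1 (fun psi => act (qop T) psi d') (act_t _))
    (linear_map0 (act_linearl (qop T) d'))).
by rewrite act_btd scaler0 subr0.
Qed.

End Ideal.

(** Weights on the torus with coordinates omega_k (left) and omega'_k (right). *)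
Definition wt2 (i : I) (j : I + I) : K :=
  match j with inl k => p i k | inr k => (p k i)^-1 end.

Definition Urs_pi (a : FA) : Urs := aproj urel a.

Lemma Urs_triangularP : Urs_triangular r s ty n.
Proof.
pose x (j : I + I) := match j with inl i => Qw i | inr i => Qw' i end.
pose xi (j : I + I) := match j with inl i => Qwi i | inr i => Qwi' i end.
have wt0 i j : wt2 i j != 0 by case: j => k; rewrite ?invr_eq0; apply: p0.
pose chi i := torus_char (wt2 i).
have chi0 i : chi i 0 = 1 by apply: torus_char0.
have chiD i g h : chi i (g + h) = chi i g * chi i h by apply: torus_charD.
pose om k := unit_exponent (inl k : I + I).
pose om' k := unit_exponent (inr k : I + I).
have chi_om i j : chi i (om j) = p i j by apply: torus_char_unit.
have chi_om' i j : chi i (om' j) = (p j i)^-1 by apply: torus_char_unit.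
have w_inv := @ugen_ww K r s ty n; have w'_inv := @ugen_w'w' K r s ty n.
have x_inv (j : I + I) : gen Urs_pi (x j) * gen Urs_pi (xi j) = 1 /\
    gen Urs_pi (xi j) * gen Urs_pi (x j) = 1.
  have w_comm y z : toral y -> toral z ->
    gen Urs_pi y * gen Urs_pi z = gen Urs_pi z * gen Urs_pi y by exact: ugen_comm.
  case: j => i; split; first exact: w_inv.
  - by rewrite [LHS](w_comm (Qwi i) (Qw i)) //; exact: w_inv.
  - exact: w'_inv.
  by rewrite [LHS](w_comm (Qwi' i) (Qw' i)) //; exact: w'_inv.
have x_shift (j : I + I) : shift_of om om' (x j) = unit_exponent j /\
    shift_of om om' (xi j) = - unit_exponent j by case: j.
have x_toral (j : I + I) : toral (x j) && toral (xi j) by case: j.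
have gen_toral (y : qgen I) : toral y -> gen Urs_pi y =
    laurent_monomial (fun j => gen Urs_pi (x j))
      (fun j => gen Urs_pi (xi j)) (shift_of om om' y).
  by case: y => // i _; rewrite (laurent_unit, laurentN_unit).
have defX : Urs_w r s (n := n) = fun j => gen Urs_pi (x j).
  by apply/funext; case.
have defXI : Urs_wi r s (n := n) = fun j => gen Urs_pi (xi j).
  by apply/funext; case.
have pi_linear : linear Urs_pi by exact: aproj_is_linear.
have pi_mul : monoid_morphism Urs_pi by exact: aproj_is_monoid_morphism.
have pi_sec : cancel (fun a : Urs => arepr a) Urs_pi by exact: areprK.
have pi_ker (T : lmodType K) (phi : {ffun I + I -> int} -> seq I -> seq I -> T) (a : FA) :
    kills serre phi -> Urs_pi a = 0 ->
  act (qop chi om om' (@ef_const K r s ty n) T) phi a = 0.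
  exact: act_urel_ideal.
rewrite /Urs_triangular defX defXI.
split; [apply: (laurent_torus n_adm r0 s0 chi_om chi_om' pi_linear pi_mul pi_sec)
  | apply: (triangular n_adm r0 s0 chi0 chiD chi_om chi_om' pi_linear pi_mul pi_sec)] => //;
  exact: aproj_urel_eq0.
Qed.

Definition Urs_quot_pi (a : FA) : Urs_quot := aproj (hopf_ideal_gen torus_rel) (aproj urel a).

Lemma Urs_quot_triangularP : (forall i j : I, p i j = p j i) ->
  Urs_quot_triangular r s ty n.
Proof.
move=> pC.
have wt0 (i j : I) : p i j != 0 by apply: p0.
pose chi (i : I) (g : {ffun I -> int}) := torus_char (fun j : I => p i j) g.
have chi0 i : chi i 0 = 1 by exact: torus_char0.
have chiD i g h : chi i (g + h) = chi i g * chi i h by exact: torus_charD.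
pose om (k : I) := unit_exponent k; pose om' (k : I) := - unit_exponent k.
have chi_om i j : chi i (om j) = p i j by apply: torus_char_unit.
have chi_om' i j : chi i (om' j) = (p j i)^-1.
  by rewrite (chiN chi0 chiD) chi_om pC.
have w_inv i : qgen_quot (Qw i) * qgen_quot (Qwi i) = 1.
  by rewrite /qgen_quot -rmorphM ugen_ww rmorph1.
have w'_inv i : qgen_quot (Qw' i) * qgen_quot (Qwi' i) = 1.
  by rewrite /qgen_quot -rmorphM ugen_w'w' rmorph1.
have w_comm y z : toral y -> toral z -> qgen_quot y * qgen_quot z = qgen_quot z * qgen_quot y.
  move=> ty' tz; rewrite /qgen_quot -[LHS]rmorphM -[RHS]rmorphM.
  by congr aproj; apply: ugen_comm.
have w'E i : qgen_quot (Qw' i) = qgen_quot (Qwi i).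
  by apply/aproj_eq/ideal_gen_sub/hopf_ideal_genE/ideal_gen_sub; exists i.
have wi'E i : qgen_quot (Qwi' i) = qgen_quot (Qw i).
  by rewrite -[LHS]mul1r -(w_inv i) -mulrA -w'E w'_inv mulr1.
have pi_linear : linear Urs_quot_pi.
  by move=> k a b; rewrite /Urs_quot_pi !linearP.
have pi_mul : monoid_morphism Urs_quot_pi.
  by split=> [|a b]; rewrite /Urs_quot_pi ?rmorph1 ?rmorphM.
have pi_sec : cancel (fun a : Urs_quot => arepr (arepr a)) Urs_quot_pi.
  by move=> a; rewrite /Urs_quot_pi !areprK.
have pi_urel (a : FA) : urel a -> Urs_quot_pi a = 0.
  by move=> rel; rewrite /Urs_quot_pi (aproj_urel_eq0 rel) linear0.
have pi_ker (T : lmodType K) (phi : {ffun I -> int} -> seq I -> seq I -> T) (a : FA) :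
    kills serre phi -> Urs_quot_pi a = 0 ->
  act (qop chi om om' (@ef_const K r s ty n) T) phi a = 0.
  move=> kphi pia; apply: (act_torus_ideal chi0 chiD chi_om chi_om') => //.
  have : ideal_gen (hopf_ideal_gen torus_rel) (aproj urel a).
    by rewrite -[X in ideal_gen _ X]subr0; apply/aproj_eq; rewrite linear0.
  apply: ideal_gen_min; first exact: ideal_gen_two_sided.
  by move=> u /hopf_ideal_genE.
have gen_toral (y : qgen I) : toral y -> gen Urs_quot_pi y =
    laurent_monomial (fun j => gen Urs_quot_pi (Qw j))
      (fun j => gen Urs_quot_pi (Qwi j)) (shift_of om om' y).
  case: y => // i _ /=; rewrite ?opprK (laurent_unit, laurentN_unit) //.
    exact: w'E.
  exact: wi'E.
split; [apply: (laurent_torus n_adm r0 s0 chi_om chi_om' pi_linear pi_mul pi_sec)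
  | apply: (triangular n_adm r0 s0 chi0 chiD chi_om chi_om' pi_linear pi_mul pi_sec)] => //.
- by move=> i; split; [exact: w_inv | rewrite -[LHS]w_comm //; exact: w_inv].
- by move=> i; split; [exact: w_inv | rewrite -[LHS]w_comm //; exact: w_inv].
Qed.

End Instances.

Theorem corollary2p6 (ty : lie_type) (n : nat) (hn : admissible ty n) :
  (forall (K : fieldType) (r s : K), base_field r s ->
     Urs_triangular r s ty n) /\
  (forall (K : fieldType) (q : K), base_field q q^-1 ->
     Urs_quot_triangular q q^-1 ty n).
Proof.
split=> [K r s [_ _ r0 s0 _]|K q [_ _ q0 qV0 _]]; first exact: Urs_triangularP.
apply: Urs_quot_triangularP => // i j.
have le_n := num_bound hn.
rewrite (struct_const_one_param hn q0 (le_n i) (le_n j)) //.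
by rewrite (struct_const_one_param hn q0 (le_n j) (le_n i)) // ipC.
Qed.
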